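(* Let $K$ be a number field with ring of integers $\mathcal{O}_K$ and let $n\geq 2$ be an integer. The set of twisted forms of the standard embedding $\boldsymbol{\mu}_{n,\mathcal{O}_K}\subset\mathbf{SL}_{2,\mathcal{O}_K}$ in the fppf topology, taken up to $\mathbf{GL}_2(\mathcal{O}_K)$-conjugacy, is in bijection with the kernel $$\ker\left( H^1_{\mathrm{fl}}(\mathcal{O}_K,\mathbf{N}_{\mathbf{GL}_2}(\boldsymbol{\mu}_n)) \to H^1_{\mathrm{fl}}(\mathcal{O}_K,\mathbf{GL}_{2,\mathcal{O}_K})\right)$$ of pointed cohomology sets.
   Context: $H^1_{\mathrm{fl}}$ denotes (non-abelian) first cohomology in the fppf topology over $\operatorname{Spec}\mathcal{O}_K$, a pointed set; the kernel of a map of pointed sets is the preimage of the distinguished element. The standard embedding of $\boldsymbol{\mu}_{n,S}$ is the closed subgroup scheme $\{\operatorname{diag}(u,u^{-1}) : u^n=1\}\subset\mathbf{SL}_{2,S}\subset\mathbf{GL}_{2,S}$. A twisted form of the standard embedding (in the fppf topology) is a closed subgroup scheme $G\subset \mathbf{SL}_{2,\mathcal{O}_K}$ for which there is an fppf cover $\{S'_j\}_{j\in J}$ of $\operatorname{Spec}\mathcal{O}_K$ such that $G_{S'_j}$ is $\mathbf{GL}_2(S'_j)$-conjugate to the standard $\boldsymbol{\mu}_{n,S'_j}$ for all $j$. For a closed subgroup scheme $G\subset X$ over $S$, the normalizer $\mathbf{N}_X(G)$ is the closed subgroup scheme of $X$ representing $T\mapsto\{x\in X(T) : x\,G_T\,x^{-1}\subseteq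 G_T\}$. The map on cohomology is induced by the inclusion $\mathbf{N}_{\mathbf{GL}_2}(\boldsymbol{\mu}_n)\subset\mathbf{GL}_2$. *)

(* Defs.v *)
From HB Require Import structures.
From Stdlib Require Import Relation_Operators.
From mathcomp Require Import all_boot all_algebra fieldext.
From mathcomp Require Import boolp mpoly.

Set Implicit Arguments.
Unset Strict Implicit.
Unset Printing Implicit Defensive.

Import GRing.Theory.
Local Open Scope ring_scope.

(* The affine fppf site of a commutative ring R is used throughout: schemes   *)
(* over Spec R are replaced by their functors of points on commutative        *)
(* R-algebras.  The members of comAlgType are nonzero, which loses nothing:   *)
(* the empty scheme has exactly one map to any given scheme.                  *)

(** Ring of integers of a number field *)

Section RingOfIntegers.
Variable K : fieldExtType rat.

Definition integral_elt : {pred K} :=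
  fun x => `[< integralOver (intr : int -> K) x >].

Lemma integral_eltP x :
  reflect (integralOver (intr : int -> K) x) (x \in integral_elt).
Proof. exact: asboolP. Qed.

Fact integral_elt_subring : subring_closed integral_elt.
Proof.
split=> [|x y /integral_eltP xI /integral_eltP yI
         |x y /integral_eltP xI /integral_eltP yI]; apply/integral_eltP.
- exact: integral1.
- exact: integral_sub.
- exact: integral_mul.
Qed.

HB.instance Definition _ :=
  GRing.isSubringClosed.Build K integral_elt integral_elt_subring.

Record ringOfIntegers : Type :=
  RingOfIntegers { int_val :> K; _ : int_val \in integral_elt }.

HB.instance Definition _ := [isSub for int_val].
HB.instance Definition _ := [Choice of ringOfIntegers by <:].
HB.instance Definition _ :=
  [SubChoice_isSubComNzRing of ringOfIntegers by <:].

End RingOfIntegers.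

(** Quotients *)

(* The quotient of T by the equivalence relation generated by r, realised as  *)
(* its set of equivalence classes.                                            *)
Definition eqv_class (T : Type) (r : T -> T -> Prop) (x : T) : T -> Prop :=
  clos_refl_sym_trans T r x.

Definition quot (T : Type) (r : T -> T -> Prop) : Type :=
  {C : T -> Prop | exists x, C = eqv_class r x}.

Definition quot_pi (T : Type) (r : T -> T -> Prop) (x : T) : quot r :=
  exist _ (eqv_class r x) (ex_intro _ x erefl).

Section QuotMap.
Variables (T T' : Type) (r : T -> T -> Prop) (r' : T' -> T' -> Prop).
Variables (f : T -> T') (f_r : forall x y, r x y -> r' (f x) (f y)).

Fact quot_map_subproof (C : quot r) :
  exists y, (fun y' => exists2 x, sval C x & eqv_class r' (f x) y') =
            eqv_class r' y.
Proof.
case: C => [C [x eC]] /=; rewrite {}eC; exists (f x).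
apply/funext => y'; apply/propext.
split=> [[z xz zy']|xy']; last by exists x => //; apply: rst_refl.
apply: rst_trans zy'; elim: xz => [a b /f_r|a|a b _|a b c _ ab _ bc].
- exact: rst_step.
- exact: rst_refl.
- exact: rst_sym.
- exact: rst_trans ab bc.
Qed.

Definition quot_map (C : quot r) : quot r' :=
  exist _ (fun y => exists2 x, sval C x & eqv_class r' (f x) y)
    (quot_map_subproof C).

End QuotMap.

(** fppf coverings *)

Section Fppf.
Variable R : comNzRingType.

(* The formal sum of pure tensors s vanishes in the tensor product of N and M *)
(* over R, expressed by the universal property.                               *)
Definition tensor_eq0 (N M : lmodType R) (s : seq (N * M)) : Prop :=
  forall (P : lmodType R) (b : {bilinear N -> M -> P}),
    \sum_(x <- s) b x.1 x.2 = 0.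

Definition flat (M : lmodType R) : Prop :=
  forall (N N' : lmodType R) (f : {linear N -> N'}), injective f ->
  forall s : seq (N * M),
    tensor_eq0 [seq (f x.1, x.2) | x <- s] -> tensor_eq0 s.

Definition mpoly_ev (k : nat) (A : comAlgType R) (a : 'I_k -> A)
  (p : {mpoly R[k]}) : A := mmap (in_alg A) a p.

Definition finitely_presented (A : comAlgType R) : Prop :=
  exists (k : nat) (a : 'I_k -> A),
    (forall x, exists p, mpoly_ev a p = x) /\
    exists (l : nat) (g : 'I_l -> {mpoly R[k]}), forall p,
      mpoly_ev a p = 0 <->
      exists q : 'I_l -> {mpoly R[k]}, p = \sum_(i < l) q i * g i.

(* Every fppf covering of the affine scheme Spec R is refined by one of       *)
(* these standard ones.                                                       *)
Record fppf_cover : Type := FppfCover {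
  cover_idx : finType;
  cover_alg :> cover_idx -> comAlgType R;
  cover_flat : forall j, flat (cover_alg j);
  cover_fp : forall j, finitely_presented (cover_alg j);
  cover_surj : forall P : prime_idealr R,
    exists (j : cover_idx) (Q : prime_idealr (cover_alg j)),
      forall a : R, (a%:A \in Q) = (a \in P)
}.

Fact flat_self : flat R^o.
Proof.
move=> N N' f f_inj s s0.
pose b (x : N') (a : R^o) : N' := a *: x.
have b_bil : bilinear_for *:%R *:%R b.
  by split=> [a c x y|x c a a']; rewrite /b /= ?scalerDr ?scalerDl !scalerA
     ?[a * c]mulrC.
pose bB := bilinear_isBilinear.Build R N' R^o N' *:%R *:%R b b_bil.
pose B : {bilinear N' -> R^o -> N'} := HB.pack b bB.
have := s0 _ B; rewrite big_map /= /b.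
under eq_bigr => x _ do rewrite -linearZ.
rewrite -linear_sum => /eqP; rewrite -(linear0 f) => /eqP /f_inj sum0 P c.
rewrite (eq_bigr (fun x => c (x.2 *: x.1) (1 : R^o))); last first.
  by move=> x _; rewrite linearZl_LR /= -linearZr_LR /= /GRing.scale /= mulr1.
by rewrite -linear_sumlz sum0 linear0l.
Qed.

Fact fp_self : finitely_presented R^o.
Proof.
exists 0%N, (fun=> 0); split=> [x|].
  by exists x%:MP; rewrite /mpoly_ev mmapC /= /GRing.scale /= mulr1.
exists 0%N, (fun=> 0) => p; split=> [p0|[q ->]]; last first.
  by rewrite big_ord0 /mpoly_ev mmap0.
exists (fun=> 0); rewrite big_ord0.
have pC : p = (p@_0)%:MP.
  apply/mpolyP => k; rewrite mcoeffC (_ : k = 0%MM) ?eqxx ?mulr1 //.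
  by apply/mnmP => -[].
move: p0; rewrite pC /mpoly_ev mmapC /= /GRing.scale /= mulr1 => ->.
by rewrite mpolyC0.
Qed.

Fact surj_self (P : prime_idealr R) :
  exists (j : unit) (Q : prime_idealr R^o),
    forall a : R, (a%:A \in Q) = (a \in P).
Proof. by exists tt, P => a; rewrite /GRing.scale /= mulr1. Qed.

Definition trivial_cover : fppf_cover :=
  @FppfCover unit (fun=> R^o) (fun=> flat_self) (fun=> fp_self) surj_self.

Lemma lrmorph_eq (A B : comAlgType R) (f g : {lrmorphism A -> B}) :
  f =1 g -> f = g.
Proof.
move=> /funext.
case: f => f [[f1] [f2] [f3]]; case: g => g [[g1] [g2] [g3]] /= fg.
case: _ / fg in g1 g2 g3 *.
congr (GRing.LRMorphism.Pack (GRing.LRMorphism.Class _ _ _));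
  by congr (_ _); apply: Prop_irrelevance.
Qed.

Record refinement (U V : fppf_cover) : Type := Refinement {
  ref_idx : cover_idx V -> cover_idx U;
  ref_map : forall j, {lrmorphism U (ref_idx j) -> V j}
}.

(** Subgroup functors of GL_m *)

(* Commutative algebras carry no inverse operation, so that GL_m(T) consists  *)
(* of the matrices having an inverse, and the relation g' = x g x^-1 for x in *)
(* GL_m(T) is written g' x = x g.                                             *)
Definition GL_points (m : nat) (T : comAlgType R) (g : 'M[T]_m) : Prop :=
  exists h : 'M[T]_m, g *m h = 1%:M.

Record subgroup_functor (m : nat) : Type := SubgroupFunctor {
  points :> forall T : comAlgType R, 'M[T]_m -> Prop;
  points_map : forall (T T' : comAlgType R) (f : {lrmorphism T -> T'}) g,
    points g -> points (map_mx f g);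
  points1 : forall T : comAlgType R, points (1%:M : 'M[T]_m);
  pointsM : forall (T : comAlgType R) (g h : 'M[T]_m),
    points g -> points h -> points (g *m h);
  pointsV : forall (T : comAlgType R) (g : 'M[T]_m),
    points g -> exists2 h, points h & g *m h = 1%:M
}.

Fact GL_map m (T T' : comAlgType R) (f : {lrmorphism T -> T'}) (g : 'M[T]_m) :
  GL_points g -> GL_points (map_mx f g).
Proof. by case=> h gh; exists (map_mx f h); rewrite -map_mxM gh map_mx1. Qed.

Fact GL1 m (T : comAlgType R) : GL_points (1%:M : 'M[T]_m).
Proof. by exists 1%:M; rewrite mulmx1. Qed.

Fact GLM m (T : comAlgType R) (g h : 'M[T]_m) :
  GL_points g -> GL_points h -> GL_points (g *m h).
Proof.
move=> [g' gg'] [h' hh']; exists (h' *m g').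
by rewrite mulmxA -(mulmxA g) hh' mulmx1.
Qed.

Fact GLV m (T : comAlgType R) (g : 'M[T]_m) :
  GL_points g -> exists2 h, GL_points h & g *m h = 1%:M.
Proof. by case=> h gh; exists h => //; exists g; apply: mulmx1C. Qed.

Definition GL (m : nat) : subgroup_functor m :=
  SubgroupFunctor (@GL_map m) (@GL1 m) (@GLM m) (@GLV m).

Definition closed_in_SL (m : nat) (G : subgroup_functor m) : Prop :=
  exists E : {mpoly R[m * m]} -> Prop, forall (T : comAlgType R) (g : 'M[T]_m),
    G T g <-> \det g = 1 /\ forall p, E p -> mpoly_ev (mxvec g 0) p = 0.

(* Over A, the base changes of G and H are conjugate by an element of GL_m(A);*)
(* an A-algebra is an R-algebra T together with a morphism from A.            *)
Definition conjugate_over (A : comAlgType R) (m : nat)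
    (H G : subgroup_functor m) : Prop :=
  exists2 x : 'M[A]_m, GL_points x &
  forall (T : comAlgType R) (u : {lrmorphism A -> T}) (g : 'M[T]_m),
    G T g <-> exists2 h, H T h & g *m map_mx u x = map_mx u x *m h.

Definition normalizes (m : nat) (G : subgroup_functor m) (T : comAlgType R)
    (x : 'M[T]_m) : Prop :=
  GL_points x /\
  forall (T' : comAlgType R) (f : {lrmorphism T -> T'}) (g : 'M[T']_m),
    G T' g -> exists2 g', G T' g' & g' *m map_mx f x = map_mx f x *m g.

(** Non-abelian H^1 *)

(* H^1 of a sheaf of groups is Cech H^1: the colimit over the coverings U of  *)
(* the pointed sets of 1-cocycles on U up to cohomology.  This is the set of  *)
(* isomorphism classes of torsors.                                            *)

Section Cohomology.
Variable m : nat.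
Implicit Type G : subgroup_functor m.

(* A point of G on the overlap of the members i and j of U is given as a      *)
(* natural transformation: it associates a point of G over T with each        *)
(* T-valued point (u, v) of the overlap.                                      *)
Record cocycle (U : fppf_cover) G : Type := Cocycle {
  coc :> forall (i j : cover_idx U) (T : comAlgType R),
    {lrmorphism U i -> T} -> {lrmorphism U j -> T} -> 'M[T]_m;
  coc_in : forall i j (T : comAlgType R)
    (u : {lrmorphism U i -> T}) (v : {lrmorphism U j -> T}), G T (coc u v);
  coc_nat : forall i j (T T' : comAlgType R) (f : {lrmorphism T -> T'})
    (u : {lrmorphism U i -> T}) (v : {lrmorphism U j -> T}),
    coc (f \o u) (f \o v) = map_mx f (coc u v);
  coc_mul : forall i j k (T : comAlgType R) (u : {lrmorphism U i -> T})
    (v : {lrmorphism U j -> T}) (w : {lrmorphism U k -> T}),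
    coc u v *m coc v w = coc u w
}.

Definition cohomologous (U : fppf_cover) G (c d : cocycle U G) : Prop :=
  exists2 h : forall i, 'M[U i]_m, forall i, G (U i) (h i) &
  forall i j (T : comAlgType R)
    (u : {lrmorphism U i -> T}) (v : {lrmorphism U j -> T}),
    map_mx u (h i) *m d i j T u v = c i j T u v *m map_mx v (h j).

Section Operations.
Variables (U : fppf_cover) (G : subgroup_functor m).

Definition coc1 : cocycle U G.
Proof.
refine (@Cocycle U G (fun i j (T : comAlgType R) _ _ => 1%:M) _ _ _).
- by move=> *; apply: points1.
- by move=> *; rewrite map_mx1.
- by move=> *; rewrite mulmx1.
Defined.

Definition coc_restr (V : fppf_cover) (r : refinement U V) (c : cocycle U G) :
  cocycle V G.
Proof.
refine (@Cocycle V G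
  (fun i j (T : comAlgType R) (u : {lrmorphism V i -> T})
       (v : {lrmorphism V j -> T}) =>
     c (ref_idx r i) (ref_idx r j) T (u \o ref_map r i) (v \o ref_map r j))
  _ _ _).
- by move=> *; apply: coc_in.
- move=> i j T T' f u v; rewrite -coc_nat.
  by congr (c _ _ _ _ _); apply: lrmorph_eq.
- by move=> *; apply: coc_mul.
Defined.

Definition coc_incl (H : subgroup_functor m)
  (GH : forall (T : comAlgType R) (g : 'M[T]_m), G T g -> H T g)
  (c : cocycle U G) : cocycle U H.
Proof.
refine (@Cocycle U H (fun i j (T : comAlgType R) u v => c i j T u v) _ _ _).
- by move=> *; apply/GH/coc_in.
- by move=> *; apply: coc_nat.
- by move=> *; apply: coc_mul.
Defined.

End Operations.

Definition coc_on_cover (G : subgroup_functor m) : Type :=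
  {U : fppf_cover & cocycle U G}.

(* The relation generating the colimit, over all coverings U, of the sets of  *)
(* cohomology classes of cocycles on U.                                       *)
Definition coc_step (G : subgroup_functor m) (c d : coc_on_cover G) : Prop :=
  exists r : refinement (tag c) (tag d),
    cohomologous (coc_restr r (tagged c)) (tagged d).

Definition H1 (G : subgroup_functor m) : Type := quot (@coc_step G).

Definition H1_base (G : subgroup_functor m) : H1 G :=
  quot_pi (@coc_step G) (Tagged _ (coc1 trivial_cover G)).

Section Map.
Variables G H : subgroup_functor m.
Hypothesis GH : forall (T : comAlgType R) (g : 'M[T]_m), G T g -> H T g.

Fact coc_step_incl (c d : coc_on_cover G) : coc_step c d ->
  coc_step (Tagged (fun U => cocycle U H) (coc_incl GH (tagged c)))
           (Tagged (fun U => cocycle U H) (coc_incl GH (tagged d))).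
Proof.
by case=> r [h hG hE]; exists r; exists h => // i; apply: GH.
Qed.

Definition H1_map : H1 G -> H1 H := quot_map coc_step_incl.

Definition H1_ker : Type := {x : H1 G | H1_map x = H1_base H}.

End Map.
End Cohomology.

(** The group scheme mu_n and the normalizer of its standard embedding *)

Section Mu.
Variable n : nat.

Definition diag2 (T : comAlgType R) (u v : T) : 'M[T]_2 :=
  diag_mx (\row_(i < 2) if i == 0 then u else v).

Definition mu_points (T : comAlgType R) (g : 'M[T]_2) : Prop :=
  exists u v : T, [/\ u ^+ n = 1, u * v = 1 & g = diag2 u v].

Fact diag2M (T : comAlgType R) (u v u' v' : T) :
  diag2 u v *m diag2 u' v' = diag2 (u * u') (v * v').
Proof.
by rewrite mulmx_diag; congr diag_mx; apply/rowP => i; rewrite !mxE; case: ifP.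
Qed.

Fact diag2_1 (T : comAlgType R) : diag2 (1 : T) 1 = 1%:M.
Proof.
by apply/matrixP => i j; rewrite !mxE if_same.
Qed.

Fact exprn_inv (T : comAlgType R) (u v : T) :
  u ^+ n = 1 -> u * v = 1 -> v ^+ n = 1.
Proof. by move=> un uv; rewrite -[LHS]mul1r -un -exprMn uv expr1n. Qed.

Fact mu_map (T T' : comAlgType R) (f : {lrmorphism T -> T'}) (g : 'M[T]_2) :
  mu_points g -> mu_points (map_mx f g).
Proof.
case=> u [v [un uv ->]]; exists (f u), (f v).
split; rewrite -?rmorphXn -?rmorphM ?un ?uv ?rmorph1 //.
by rewrite map_diag_mx; congr diag_mx; apply/rowP => i; rewrite !mxE; case: ifP.
Qed.

Fact mu1 (T : comAlgType R) : mu_points (1%:M : 'M[T]_2).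
Proof. by exists 1, 1; rewrite expr1n mulr1; rewrite diag2_1. Qed.

Fact muM (T : comAlgType R) (g h : 'M[T]_2) :
  mu_points g -> mu_points h -> mu_points (g *m h).
Proof.
case=> u [v [un uv ->]] [u' [v' [un' uv' ->]]]; exists (u * u'), (v * v').
split; [by rewrite exprMn un un' mulr1 | | exact: diag2M].
by rewrite mulrACA uv uv' mulr1.
Qed.

Fact muV (T : comAlgType R) (g : 'M[T]_2) :
  mu_points g -> exists2 h, mu_points h & g *m h = 1%:M.
Proof.
case=> u [v [un uv ->]]; exists (diag2 v u).
  by exists v, u; rewrite mulrC uv (exprn_inv un uv).
by rewrite (diag2M u v v u) uv mulrC uv diag2_1.
Qed.

Definition mu : subgroup_functor 2 := SubgroupFunctor mu_map mu1 muM muV.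

Fact normalizer_map (T T' : comAlgType R) (f : {lrmorphism T -> T'})
  (x : 'M[T]_2) : normalizes mu x -> normalizes mu (map_mx f x).
Proof.
case=> xGL xN; split=> [|T'' f' g mg]; first exact: GL_map.
by have := xN _ (f' \o f : {lrmorphism T -> T''}) g mg; rewrite map_mx_comp.
Qed.

Fact normalizer1 (T : comAlgType R) : normalizes mu (1%:M : 'M[T]_2).
Proof.
split=> [|T' f g mg]; first exact: GL1.
by exists g => //; rewrite map_mx1 mulmx1 mul1mx.
Qed.

Fact normalizerM (T : comAlgType R) (x y : 'M[T]_2) :
  normalizes mu x -> normalizes mu y -> normalizes mu (x *m y).
Proof.
move=> [xGL xN] [yGL yN]; split=> [|T' f g mg]; first exact: GLM.
have [g1 mg1 e1] := yN _ f _ mg; have [g2 mg2 e2] := xN _ f _ mg1.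
by exists g2 => //; rewrite map_mxM mulmxA e2 -!mulmxA e1.
Qed.

Fact diag2_swap (T : comAlgType R) (x : 'M[T]_2) (u v u' v' : T) :
  u * v = 1 -> u' * v' = 1 ->
  diag2 u' v' *m x = x *m diag2 u v -> x *m diag2 u' v' = diag2 u v *m x.
Proof.
move=> uv uv' E; apply/matrixP => i j.
have {E} := congr1 (fun M : 'M__ => M i j) E.
rewrite !mul_diag_mx !mul_mx_diag !mxE.
have vu : v * u = 1 by rewrite mulrC.
have vu' : v' * u' = 1 by rewrite mulrC.
have i01 (k : 'I_2) : k = 0 \/ k = 1.
  by case: k => [[|[|//]] kP]; [left | right]; apply: val_inj.
have inv_swap (a b c d y : T) :
  a * b = 1 -> c * d = 1 -> c * y = y * b -> y * d = a * y.
  move=> ab cd E; rewrite -[LHS]mul1r -ab (mulrC y) mulrACA (mulrC b) -E.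
  by rewrite -mulrA (mulrA d) (mulrC d) cd mul1r.
case: (i01 i) => ->; case: (i01 j) => -> /=.
- by move=> E; rewrite [RHS]mulrC -E mulrC.
- exact: inv_swap.
- exact: inv_swap.
- by move=> E; rewrite [RHS]mulrC -E mulrC.
Qed.

Fact normalizerV (T : comAlgType R) (x : 'M[T]_2) :
  normalizes mu x -> exists2 y, normalizes mu y & x *m y = 1%:M.
Proof.
move=> [[y xy] xN]; have yx := mulmx1C xy; exists y => //.
split=> [|T' f _ [u [v [un uv ->]]]]; first by exists x.
have fxy : map_mx f x *m map_mx f y = 1%:M by rewrite -map_mxM xy map_mx1.
have fyx : map_mx f y *m map_mx f x = 1%:M by rewrite -map_mxM yx map_mx1.
have mD : mu T' (diag2 u v) by exists u, v.
have [_ [u' [v' [un' uv' ->]]] E] := xN _ f _ mD.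
exists (diag2 u' v'); first by exists u', v'.
have := diag2_swap uv uv' E; rewrite -/(diag2 u v) => E'.
rewrite -[RHS]mulmx1 -fxy mulmxA -(mulmxA _ (diag2 u v)) -E'.
by rewrite mulmxA fyx mul1mx.
Qed.

Definition normalizer_mu : subgroup_functor 2 :=
  SubgroupFunctor normalizer_map normalizer1 normalizerM normalizerV.

Fact normalizer_GL (T : comAlgType R) (x : 'M[T]_2) :
  normalizer_mu T x -> GL 2 T x.
Proof. by case. Qed.

Definition twisted_form : Type :=
  {G : subgroup_functor 2 | closed_in_SL G /\
    exists U : fppf_cover, forall j, conjugate_over (U j) mu G}.

Definition forms_up_to_conj : Type :=
  quot (fun G H : twisted_form => conjugate_over R^o (sval G) (sval H)).

End Mu.
End Fppf.

Arguments mu R n : clear implicits.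
Arguments normalizer_mu R n : clear implicits.
Arguments twisted_form R n : clear implicits.
Arguments forms_up_to_conj R n : clear implicits.

(* Main.v *)
Require Import Defs.
From HB Require Import structures.
From Stdlib Require Import Relation_Operators.
From mathcomp Require Import all_boot all_algebra fieldext.
From mathcomp Require Import boolp mpoly ring.
From mathcomp Require classical_sets.

(** A twisted form F of mu_n becomes, on the members U_i of some covering, the
    conjugate x_i mu_n x_i^-1 of the standard embedding.  The transition
    matrices x_i^-1 x_j conjugate mu_n to itself, so they form a cocycle with
    values in the normalizer N, which the x_i split in GL_2.  Such a splitting
    x of a cocycle c is called a frame of c, and F is presented by c when c has
    a frame x with F = x mu_n x^-1.  The bijection is the one that this
    relation induces between conjugacy classes of forms and classes of
    cocycles having a frame, which are the classes in the kernel.  The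
    argument works over every commutative ring R.

    The relation passes to the quotients because of the following.  Two
    coverings both refine their disjoint union, on which the frames of a form
    fit together; hence the class of the cocycle depends on F only
    (presents_class).  Two forms with frames of the same cocycle are conjugate
    by the quotients y_j x_j^-1, which agree on overlaps and descend to a
    matrix over R (presents_unique).  Along a refinement, a frame is carried to
    the finer covering by restriction (frame_push), and to the coarser one by
    descent over each of its members (frame_pull).

    Descent is faithfully flat descent of elements: a family of elements of T,
    one for each T-point of Spec A having a lift to the covering, is an element
    of A as soon as it is natural and independent of the lift
    (cover_descent).  It comes from the fact that an element of a module which
    dies after tensoring with each member of the covering is zero
    (cover_faithful).

    There remains to show that a frame of an N-valued cocycle defines a
    subgroup of SL_2 that is cut out by polynomials over R (frame_equations).
    The conjugate of mu_n by x consists of the matrices g with det g = 1 and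
    g^n = 1 which commute with the idempotent e = x diag(1,0) x^-1.  If n = 2
    then g is a scalar, and one may require it to commute with all matrices.
    If n > 2, an element of N replaces e by t e + (1 - t)(1 - e) for some
    idempotent t (normalizer_split_proj), so that e - e_00 is multiplied by
    2t - 1, a square root of 1.  The products of two entries of e - e_00 are
    thus elements of R; and these entries generate the unit ideal, so
    commuting with e amounts to equations with coefficients in R. *)

Set Implicit Arguments.
Unset Strict Implicit.
Unset Printing Implicit Defensive.

Import GRing.Theory.
Local Open Scope ring_scope.

(** * Quotients, products and tensor products of modules *)
Section LinearMaps.
Variables (R : comNzRingType) (N P : lmodType R) (f : N -> P) (fL : linear f).

Definition linear_of : {linear N -> P} :=
  HB.pack f (GRing.isLinear.Build R N P *:%R f fL).

End LinearMaps.

Section QuotientModule.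
Variables (R : comNzRingType) (M : lmodType R) (S : zmodClosed M).
Hypothesis SZ : forall a x, x \in S -> a *: x \in S.

Definition quotient_module of (forall a x, x \in S -> a *: x \in S) :=
  Quotient.quot S.
Local Notation Q := (quotient_module SZ).
HB.instance Definition _ := GRing.Zmodule.on Q.

Let cls (x : M) : Q := \pi_(Q)%qT x.

Let clsD x y : cls (x + y) = cls x + cls y.
Proof. exact: (raddfD (\pi_(Q)%qT : {additive M -> Quotient.quot S})). Qed.

Let cls_eq x y : cls x = cls y <-> x - y \in S.
Proof.
split=> [E|xy]; last by apply/eqP; rewrite -Quotient.idealrBE.
by rewrite Quotient.idealrBE; apply/eqP.
Qed.

Let clsK (q : Q) : cls (repr q) = q.
Proof. exact: reprK. Qed.

Let scale (a : R) (q : Q) := cls (a *: repr q).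

Let scale_cls a x : scale a (cls x) = cls (a *: x).
Proof.
by apply/cls_eq; rewrite -scalerBr; apply: SZ; apply/cls_eq; rewrite clsK.
Qed.

Fact quotient_scalerA a b q : scale a (scale b q) = scale (a * b) q.
Proof. by rewrite -[q]clsK !scale_cls scalerA. Qed.

Fact quotient_scale1r : left_id 1 scale.
Proof. by move=> q; rewrite -[q]clsK scale_cls scale1r. Qed.

Fact quotient_scalerDr : right_distributive scale +%R.
Proof.
by move=> a q q'; rewrite -[q]clsK -[q']clsK -clsD !scale_cls scalerDr clsD.
Qed.

Fact quotient_scalerDl q : {morph scale^~ q : a b / a + b}.
Proof. by move=> a b; rewrite -[q]clsK !scale_cls scalerDl clsD. Qed.

HB.instance Definition _ := GRing.Zmodule_isLmodule.Build R Q
  quotient_scalerA quotient_scale1r quotient_scalerDr quotient_scalerDl.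

Definition to_quotient (x : M) : Q := cls x.

Fact to_quotient_linear : linear to_quotient.
Proof. by move=> a x y; rewrite /to_quotient clsD -scale_cls. Qed.

HB.instance Definition _ :=
  GRing.isLinear.Build R M Q *:%R to_quotient to_quotient_linear.

Lemma to_quotient_surj q : exists x, q = to_quotient x.
Proof. by exists (repr q); rewrite /to_quotient clsK. Qed.

Lemma to_quotient_eq0 x : to_quotient x = 0 <-> x \in S.
Proof. by rewrite -(linear0 to_quotient) cls_eq subr0. Qed.

Section Lift.
Variables (P : lmodType R) (g : {linear M -> P}).
Hypothesis g0 : forall x, x \in S -> g x = 0.

Let lift (q : Q) : P := g (repr q).

Let liftE x : lift (to_quotient x) = g x.
Proof.
apply/subr0_eq; rewrite -[LHS](linearB g); apply: g0.
by apply/to_quotient_eq0; rewrite linearB /= [to_quotient (repr _)]clsK subrr.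
Qed.

Fact quotient_lift_linear : linear lift.
Proof.
move=> a q q'; have [[x ->] [y ->]] := (to_quotient_surj q, to_quotient_surj q').
by rewrite -linearP !liftE linearP.
Qed.

Definition quotient_lift : {linear Q -> P} := linear_of quotient_lift_linear.

Lemma quotient_liftE x : quotient_lift (to_quotient x) = g x.
Proof. exact: liftE. Qed.

End Lift.
End QuotientModule.

Section ProductModule.
Variables (R : comNzRingType) (I : finType) (M : I -> lmodType R).

Definition product_module := forall i, M i.

HB.instance Definition _ := gen_eqMixin product_module.
HB.instance Definition _ := gen_choiceMixin product_module.

Let ext (x y : product_module) : (forall i, x i = y i) -> x = y.
Proof. exact: functional_extensionality_dep. Qed.

Let zero : product_module := fun=> 0.
Let add (x y : product_module) : product_module := fun i => x i + y i.
Let opp (x : product_module) : product_module := fun i => - x i.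
Let scale a (x : product_module) : product_module := fun i => a *: x i.

Fact product_addrA : associative add.
Proof. by move=> x y z; apply: ext => i; apply: addrA. Qed.
Fact product_addrC : commutative add.
Proof. by move=> x y; apply: ext => i; apply: addrC. Qed.
Fact product_add0r : left_id zero add.
Proof. by move=> x; apply: ext => i; apply: add0r. Qed.
Fact product_addNr : left_inverse zero opp add.
Proof. by move=> x; apply: ext => i; apply: addNr. Qed.

HB.instance Definition _ := GRing.isZmodule.Build product_module
  product_addrA product_addrC product_add0r product_addNr.

Fact product_scalerA a b x : scale a (scale b x) = scale (a * b) x.
Proof. by apply: ext => i; apply: scalerA. Qed.
Fact product_scale1r : left_id 1 scale.
Proof. by move=> x; apply: ext => i; apply: scale1r. Qed.
Fact product_scalerDr : right_distributive scale +%R.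
Proof. by move=> a x y; apply: ext => i; apply: scalerDr. Qed.
Fact product_scalerDl x : {morph scale^~ x : a b / a + b}.
Proof. by move=> a b; apply: ext => i; apply: scalerDl. Qed.

HB.instance Definition _ := GRing.Zmodule_isLmodule.Build R product_module
  product_scalerA product_scale1r product_scalerDr product_scalerDl.

Definition product_inj i (x : M i) : product_module :=
  dfwith (fun j => 0 : M j) x.

Fact product_inj_linear i : linear (@product_inj i).
Proof.
move=> a x y; apply: ext => j; rewrite /product_inj.
change (dfwith (fun j => 0 : M j) (a *: x + y) j =
  a *: dfwith (fun j => 0 : M j) x j + dfwith (fun j => 0 : M j) y j).
have [<-|ij] := eqVneq i j; first by rewrite !dfwith_in.
by rewrite !dfwith_out // scaler0 addr0.
Qed.

HB.instance Definition _ i := GRing.isLinear.Build R (M i) product_module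
  *:%R (@product_inj i) (@product_inj_linear i).

Lemma product_sum_inj (x : product_module) : x = \sum_i product_inj (x i).
Proof.
apply: ext => j; rewrite (big_morph (fun y : product_module => y j)
  (id1 := 0) (op1 := +%R)) //.
rewrite (bigD1 j) //= big1 ?addr0 => [|i ij];
  first by rewrite /product_inj dfwith_in.
by rewrite /product_inj dfwith_out.
Qed.

End ProductModule.

Section BilinearMaps.
Variables (R : comNzRingType) (N M P : lmodType R) (b : N -> M -> P).
Hypotheses (bl : forall y, linear (b^~ y)) (br : forall x, linear (b x)).

Fact bilinear_of_subproof : bilinear_for *:%R *:%R b.
Proof. by split=> [y a x x'|x a y y']; [apply: bl | apply: br]. Qed.

Definition bilinear_of : {bilinear N -> M -> P} :=
  HB.pack b (bilinear_isBilinear.Build R N M P *:%R *:%R b bilinear_of_subproof).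

End BilinearMaps.

Section Tensor.
Variables (R : comNzRingType) (N M : lmodType R).

Definition tensor_sum (P : lmodType R) (b : {bilinear N -> M -> P})
  (s : seq (N * M)) : P := \sum_(x <- s) b x.1 x.2.

(** The tensor product is made of formal sums of pure tensors, two sums being
    identified when no bilinear map separates them.  In this way it vanishes
    exactly when the condition used to define flatness says so. *)
Definition tensor_eqv (s s' : seq (N * M)) : bool :=
  `[< forall (P : lmodType R) (b : {bilinear N -> M -> P}),
        tensor_sum b s = tensor_sum b s' >].

Fact tensor_eqv_equiv : equiv_class_of tensor_eqv.
Proof.
split=> [s|s s'|s' s s''].
- exact/asboolP.
- by apply/asboolP/asboolP => E P b; rewrite E.
- by move=> /asboolP E /asboolP E'; apply/asboolP => P b; rewrite E E'.
Qed.

Canonical tensor_equiv_rel := EquivRelPack tensor_eqv_equiv.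

Definition tensor := {eq_quot tensor_eqv}%qT.
HB.instance Definition _ := Choice.on tensor.

Definition of_sum (s : seq (N * M)) : tensor := \pi_(tensor)%qT s.

Definition tensor_lift (P : lmodType R) (b : {bilinear N -> M -> P})
  (t : tensor) : P :=
  tensor_sum b (repr t).

Lemma tensor_lift_sum (P : lmodType R) (b : {bilinear N -> M -> P}) s :
  tensor_lift b (of_sum s) = tensor_sum b s.
Proof.
suff /eqmodP/asboolP E : (repr (of_sum s) = s %[mod tensor])%qT by apply: E.
exact: reprK.
Qed.

Lemma tensor_ext (t t' : tensor) :
  (forall (P : lmodType R) (b : {bilinear N -> M -> P}),
     tensor_lift b t = tensor_lift b t') ->
  t = t'.
Proof.
by move=> E; rewrite -[t]reprK -[t']reprK; apply/eqmodP/asboolP => P b; apply: E.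
Qed.

Let zero := of_sum [::].
Let add (t t' : tensor) := of_sum (repr t ++ repr t').
Let scale (a : R) (t : tensor) := of_sum [seq (a *: x.1, x.2) | x <- repr t].
Let opp := scale (- 1).

Let lift0 P b : @tensor_lift P b zero = 0.
Proof. by rewrite tensor_lift_sum /tensor_sum big_nil. Qed.

Let liftD P b t t' :
  @tensor_lift P b (add t t') = tensor_lift b t + tensor_lift b t'.
Proof. by rewrite tensor_lift_sum /tensor_sum big_cat. Qed.

Let liftZ P b a t : @tensor_lift P b (scale a t) = a *: tensor_lift b t.
Proof.
rewrite tensor_lift_sum /tensor_lift /tensor_sum big_map scaler_sumr.
by apply: eq_bigr => x _; rewrite linearZl_LR.
Qed.

Let liftE := (lift0, liftD, liftZ).

Fact tensor_addrA : associative add.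
Proof. by move=> ???; apply: tensor_ext => P b; rewrite !liftE addrA. Qed.
Fact tensor_addrC : commutative add.
Proof. by move=> ??; apply: tensor_ext => P b; rewrite !liftE addrC. Qed.
Fact tensor_add0r : left_id zero add.
Proof. by move=> ?; apply: tensor_ext => P b; rewrite !liftE add0r. Qed.
Fact tensor_addNr : left_inverse zero opp add.
Proof. by move=> ?; apply: tensor_ext => P b; rewrite !liftE scaleN1r addNr. Qed.

HB.instance Definition _ := GRing.isZmodule.Build tensor
  tensor_addrA tensor_addrC tensor_add0r tensor_addNr.

Fact tensor_scalerA a a' t : scale a (scale a' t) = scale (a * a') t.
Proof. by apply: tensor_ext => P b; rewrite !liftE scalerA. Qed.
Fact tensor_scale1r : left_id 1 scale.
Proof. by move=> ?; apply: tensor_ext => P b; rewrite !liftE scale1r. Qed.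
Fact tensor_scalerDr : right_distributive scale +%R.
Proof.
by move=> ???; apply: tensor_ext => P b; rewrite !(liftD, liftZ) scalerDr.
Qed.
Fact tensor_scalerDl t : {morph scale^~ t : a a' / a + a'}.
Proof.
by move=> ??; apply: tensor_ext => P b; rewrite !(liftD, liftZ) scalerDl.
Qed.

HB.instance Definition _ := GRing.Zmodule_isLmodule.Build R tensor
  tensor_scalerA tensor_scale1r tensor_scalerDr tensor_scalerDl.

Fact tensor_lift_linear (P : lmodType R) (b : {bilinear N -> M -> P}) :
  linear (tensor_lift b).
Proof. by move=> a t t'; rewrite liftD liftZ. Qed.

HB.instance Definition _ (P : lmodType R) (b : {bilinear N -> M -> P}) :=
  GRing.isLinear.Build R tensor P *:%R (tensor_lift b) (tensor_lift_linear b).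

Definition pure (x : N) (y : M) : tensor := of_sum [:: (x, y)].

Lemma tensor_lift_pure (P : lmodType R) (b : {bilinear N -> M -> P}) x y :
  tensor_lift b (pure x y) = b x y.
Proof. by rewrite tensor_lift_sum /tensor_sum big_seq1. Qed.

Fact pure_linearl y : linear (pure^~ y).
Proof.
move=> a x x'; apply: tensor_ext => P b.
by rewrite linearP /= !tensor_lift_pure linearPl.
Qed.

Fact pure_linearr x : linear (pure x).
Proof.
move=> a y y'; apply: tensor_ext => P b.
by rewrite linearP /= !tensor_lift_pure linearPr.
Qed.

HB.instance Definition _ := bilinear_isBilinear.Build R N M tensor *:%R *:%R
  pure (bilinear_of_subproof pure_linearl pure_linearr).

Lemma tensor_sumP (t : tensor) :
  exists s : seq (N * M), t = \sum_(x <- s) pure x.1 x.2.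
Proof.
exists (repr t); apply: tensor_ext => P b.
by rewrite linear_sum; apply: eq_bigr => x _; rewrite /= tensor_lift_pure.
Qed.

(** Links the tensor module to the relation that defines flatness. *)
Lemma tensor_sum_eq0 (s : seq (N * M)) :
  \sum_(x <- s) pure x.1 x.2 = 0 <-> tensor_eq0 s.
Proof.
split=> [s0 P b|s0]; last exact: (s0 tensor pure).
transitivity (tensor_lift b (\sum_(x <- s) pure x.1 x.2)).
  by rewrite linear_sum; apply: eq_bigr => x _; rewrite /= tensor_lift_pure.
by rewrite s0 linear0.
Qed.

End Tensor.

(** * Tensor products of algebras *)
Section TensorAlgebra.
Variables (R : comNzRingType) (A B : comAlgType R).
Local Notation T := (tensor A B).

Section Multiplication.
Variables (P : lmodType R) (b : {bilinear A -> B -> P}).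

Fact mul_arg_l x' y' y : linear (fun x => b (x * x') (y * y')).
Proof. by move=> a x1 x2; rewrite mulrDl -scalerAl linearPl. Qed.
Fact mul_arg_r x' y' x : linear (fun y => b (x * x') (y * y')).
Proof. by move=> a y1 y2; rewrite mulrDl -scalerAl linearPr. Qed.

Definition mul_arg (z : A * B) : {bilinear A -> B -> P} :=
  bilinear_of (mul_arg_l z.1 z.2) (mul_arg_r z.1 z.2).

Fact mul_fun_l (t : T) y : linear (fun x => tensor_lift (mul_arg (x, y)) t).
Proof.
move=> a x1 x2; rewrite /tensor_lift /tensor_sum scaler_sumr -big_split /=.
by apply: eq_bigr => z _; rewrite mulrDr -scalerAr linearPl.
Qed.
Fact mul_fun_r (t : T) x : linear (fun y => tensor_lift (mul_arg (x, y)) t).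
Proof.
move=> a y1 y2; rewrite /tensor_lift /tensor_sum scaler_sumr -big_split /=.
by apply: eq_bigr => z _; rewrite mulrDr -scalerAr linearPr.
Qed.

Definition mul_fun (t : T) : {bilinear A -> B -> P} :=
  bilinear_of (mul_fun_l t) (mul_fun_r t).

End Multiplication.

(** In x (x) y times x' (x) y', the second factor enters through the bilinear
    map that it defines, and the first one is then lifted along this map. *)
Definition tensor_mul (t t' : T) : T :=
  tensor_lift (mul_fun (@pure R A B : {bilinear A -> B -> T}) t') t.

Lemma tensor_mul_pure x y x' y' :
  tensor_mul (pure x y) (pure x' y') = pure (x * x') (y * y').
Proof.
rewrite /tensor_mul !tensor_lift_pure /= tensor_lift_pure /=.
by rewrite (mulrC x') (mulrC y').
Qed.

Lemma tensor_ind (K : T -> Prop) :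
  (forall x y, K (pure x y)) -> (forall t t', K t -> K t' -> K (t + t')) ->
  K 0 -> forall t, K t.
Proof. by move=> Kp KD K0 t; have [s ->] := tensor_sumP t; apply: big_ind. Qed.

Fact tensor_mulDl : left_distributive tensor_mul +%R.
Proof. by move=> t1 t2 t; rewrite /tensor_mul linearD. Qed.

Fact tensor_mulDr : right_distributive tensor_mul +%R.
Proof.
move=> t t1 t2; elim/tensor_ind: t => [x y|t t' E E'|].
- by rewrite /tensor_mul !tensor_lift_pure /= linearD.
- by rewrite !tensor_mulDl E E' addrACA.
- by rewrite /tensor_mul !linear0 addr0.
Qed.

Fact tensor_mul0l t : tensor_mul 0 t = 0.
Proof. by rewrite /tensor_mul linear0. Qed.

Fact tensor_mulC : commutative tensor_mul.
Proof.
have mul0r t : tensor_mul t 0 = 0.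
  by apply: (addrI (tensor_mul t 0)); rewrite -tensor_mulDr !addr0.
move=> t t'; elim/tensor_ind: t => [x y|t1 t2 E E'|]; last 2 first.
- by rewrite tensor_mulDl tensor_mulDr E E'.
- by rewrite mul0r tensor_mul0l.
elim/tensor_ind: t' => [x' y'|t1 t2 E E'|]; last 2 first.
- by rewrite tensor_mulDl tensor_mulDr E E'.
- by rewrite mul0r tensor_mul0l.
by rewrite !tensor_mul_pure (mulrC x) (mulrC y).
Qed.

Fact tensor_mulA : associative tensor_mul.
Proof.
have mul0r t : tensor_mul t 0 = 0 by rewrite tensor_mulC tensor_mul0l.
move=> t t' t''; elim/tensor_ind: t => [x y|t1 t2 E E'|]; last 2 first.
- by rewrite !tensor_mulDl E E'.
- by rewrite !tensor_mul0l.
elim/tensor_ind: t' => [x' y'|t1 t2 E E'|]; last 2 first.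
- by rewrite !(tensor_mulDl, tensor_mulDr) E E'.
- by rewrite !(tensor_mul0l, mul0r).
elim/tensor_ind: t'' => [x'' y''|t1 t2 E E'|]; last 2 first.
- by rewrite !tensor_mulDr E E'.
- by rewrite !mul0r.
by rewrite !tensor_mul_pure !mulrA.
Qed.

Fact tensor_mul1 : left_id (pure 1 1) tensor_mul.
Proof.
elim/tensor_ind => [x y|t t' E E'|].
- by rewrite tensor_mul_pure !mul1r.
- by rewrite tensor_mulDr E E'.
- by rewrite tensor_mulC tensor_mul0l.
Qed.

Fact tensor_scalerAl (a : R) (t t' : T) :
  a *: tensor_mul t t' = tensor_mul (a *: t) t'.
Proof. by rewrite /tensor_mul linearZ. Qed.

(** Algebras being nonzero, this is one only if 1 (x) 1 is nonzero; otherwise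
    the tensor product is zero (tensor_trivial). *)
Definition tensor_alg of (pure 1 1 != 0 :> T) : Type := T.

Section NonZero.
Hypothesis nz : pure 1 1 != 0 :> T.
Local Notation TA := (tensor_alg nz).

HB.instance Definition _ := GRing.Lmodule.on TA.
HB.instance Definition _ := GRing.Zmodule_isComNzRing.Build TA
  tensor_mulA tensor_mulC tensor_mul1 tensor_mulDl nz.
HB.instance Definition _ := GRing.Lmodule_isLalgebra.Build R TA tensor_scalerAl.
HB.instance Definition _ := GRing.Lalgebra_isComAlgebra.Build R TA.

Definition tensor_inl (x : A) : TA := pure x 1.
Definition tensor_inr (y : B) : TA := pure 1 y.

Fact tensor_inl_linear : linear tensor_inl.
Proof. exact: pure_linearl. Qed.
Fact tensor_inr_linear : linear tensor_inr.
Proof. exact: pure_linearr. Qed.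
Fact tensor_inl_monoid : monoid_morphism tensor_inl.
Proof. by split=> // x x'; rewrite [RHS]tensor_mul_pure mulr1. Qed.
Fact tensor_inr_monoid : monoid_morphism tensor_inr.
Proof. by split=> // x x'; rewrite [RHS]tensor_mul_pure mulr1. Qed.

HB.instance Definition _ :=
  GRing.isLinear.Build R A TA *:%R tensor_inl tensor_inl_linear.
HB.instance Definition _ :=
  GRing.isMonoidMorphism.Build A TA tensor_inl tensor_inl_monoid.
HB.instance Definition _ :=
  GRing.isLinear.Build R B TA *:%R tensor_inr tensor_inr_linear.
HB.instance Definition _ :=
  GRing.isMonoidMorphism.Build B TA tensor_inr tensor_inr_monoid.

Lemma tensor_inlrM x y : tensor_inl x * tensor_inr y = pure x y.
Proof. by rewrite [LHS]tensor_mul_pure mulr1 mul1r. Qed.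

Section Universal.
Variables (C : comAlgType R) (u : {lrmorphism A -> C}) (v : {lrmorphism B -> C}).

Fact copair_l y : linear (fun x => u x * v y).
Proof. by move=> a x x'; rewrite linearP mulrDl -scalerAl. Qed.
Fact copair_r x : linear (fun y => u x * v y).
Proof. by move=> a x1 x'; rewrite linearP mulrDr -scalerAr. Qed.

(** The tensor product is the coproduct of commutative algebras. *)
Definition tensor_copair : TA -> C :=
  tensor_lift (bilinear_of copair_l copair_r).

Lemma tensor_copair_pure x y : tensor_copair (pure x y) = u x * v y.
Proof. exact: tensor_lift_pure. Qed.

Fact tensor_copair_monoid : monoid_morphism tensor_copair.
Proof.
split=> [|t t']; first by rewrite [LHS]tensor_copair_pure !rmorph1 mulr1.
rewrite /tensor_copair.
elim/tensor_ind: t => [x y|t1 t2 E E'|]; last 2 first.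
- by rewrite mulrDl !linearD /= mulrDl E E'.
- by rewrite mul0r !linear0 /= mul0r.
elim/tensor_ind: t' => [x' y'|t1 t2 E E'|]; last 2 first.
- by rewrite mulrDr !linearD /= mulrDr E E'.
- by rewrite mulr0 !linear0 /= mulr0.
rewrite [_ * _]tensor_mul_pure -/tensor_copair !tensor_copair_pure.
by rewrite !rmorphM mulrACA.
Qed.

HB.instance Definition _ := GRing.Linear.on tensor_copair.
HB.instance Definition _ :=
  GRing.isMonoidMorphism.Build TA C tensor_copair tensor_copair_monoid.

Lemma tensor_copairl x : tensor_copair (tensor_inl x) = u x.
Proof. by rewrite [LHS]tensor_copair_pure rmorph1 mulr1. Qed.
Lemma tensor_copairr y : tensor_copair (tensor_inr y) = v y.
Proof. by rewrite [LHS]tensor_copair_pure rmorph1 mul1r. Qed.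

End Universal.
End NonZero.

(** An overlap with a point is nonempty: the copairing sends 1 (x) 1 to 1. *)
Lemma tensor_nonzero (C : comAlgType R) (u : {lrmorphism A -> C})
  (v : {lrmorphism B -> C}) : pure 1 1 != 0 :> T.
Proof.
apply/eqP => E.
have := tensor_lift_pure (bilinear_of (copair_l u v) (copair_r u v)) 1 1.
by rewrite E linear0 /= !rmorph1 mulr1 => /esym/eqP; rewrite oner_eq0.
Qed.

Lemma tensor_trivial (t : T) : pure 1 1 = 0 :> T -> t = 0.
Proof. by move=> E; rewrite -[t]tensor_mul1 E tensor_mul0l. Qed.

End TensorAlgebra.

Arguments tensor_copair {R A B} nz {C} u v t.

(** * Faithful flatness *)
Section Krull.
Variables (R : comNzRingType) (I : R -> Prop).

Definition is_ideal (J : R -> Prop) : Prop :=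
  J 0 /\ forall a x y, J x -> J y -> J (a * x + y).

Hypotheses (I_ideal : is_ideal I) (I_proper : ~ I 1).

Let is_idealD J x y : is_ideal J -> J x -> J y -> J (x + y).
Proof. by case=> _ JP Jx Jy; rewrite -[x]mul1r; apply: JP. Qed.
Let is_idealM J a x : is_ideal J -> J x -> J (a * x).
Proof. by case=> J0 JP Jx; rewrite -[_ * _]addr0; apply: JP. Qed.

(** A set X maximal among those for which the union of X and I is a proper
    ideal gives a maximal ideal.  Taking the union with I lets the empty chain
    have an upper bound. *)
Lemma exists_prime_above : exists P : prime_idealr R, forall x, I x -> x \in P.
Proof.
pose up (X : R -> Prop) x := X x \/ I x.
pose good X := is_ideal (up X) /\ ~ up X 1.
have chain (F : classical_sets.set (R -> Prop)) :
    (forall X, F X -> good X) ->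
    (forall X Y, F X -> F Y -> (forall x, X x -> Y x) \/ (forall x, Y x -> X x)) ->
    good (fun x => exists2 X, F X & X x).
  move=> Fgood Ftot; split; last first.
    by case=> [[X FX X1]|//]; have [_ []] := Fgood _ FX; left.
  split=> [|a x y]; first by right; case: I_ideal.
  have sub X z : F X -> up X z -> up (fun x => exists2 X, F X & X x) z.
    by move=> FX [Xz|Iz]; [left; exists X | right].
  have stable X x' y' : F X -> up X x' -> up X y' ->
      up (fun x => exists2 X, F X & X x) (a * x' + y').
    move=> FX Xx Xy; apply: (sub X) => //.
    by have [[_ XP] _] := Fgood _ FX; apply: XP.
  case=> [[X FX Xx]|Ix] [[Y FY Yy]|Iy].
  - case: (Ftot _ _ FX FY) => XY.
    + by apply: (stable Y) => //; left => //; apply: XY.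
    + by apply: (stable X) => //; left => //; apply: XY.
  - by apply: (stable X) => //; [left | right].
  - by apply: (stable Y) => //; [right | left].
  - by right; case: I_ideal => _; apply.
have [A [[Aid A1] Amax]] := @classical_sets.Zorn_bigcup R good
  (fun F FP Ft => chain F FP Ft).
pose M : {pred R} := fun x => `[< up A x >].
have ME x : (x \in M) = `[< up A x >] by [].
have Mmax z : z \notin M -> exists m a, up A m /\ 1 = m + a * z.
  move=> /asboolP Mz; apply: contrapT => nz.
  pose B x := exists m a, up A m /\ x = m + a * z.
  have AB x : up A x -> B x by move=> Ax; exists x, 0; rewrite mul0r addr0.
  have upB x : up B x -> B x by case=> // Ix; apply: AB; right.
  have Bid : is_ideal B.
    split=> [|a x y [m [c [Mm ->]]] [m' [c' [Mm' ->]]]].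
      by apply: AB; case: Aid.
    exists (a * m + m'), (a * c + c'); split; first by case: Aid => _; apply.
    by rewrite mulrDr mulrDl mulrA addrACA.
  apply: (Amax B).
    split=> [x Ax|BA]; first by apply: AB; left.
    apply: Mz; left; apply: BA; exists 0, 1; rewrite mul1r add0r.
    by split=> //; case: Aid.
  split=> [|/upB/nz]; last by [].
  have upBE : up B = B.
    by apply/funext => x; apply/propext; split=> [/upB|]; [|left].
  by rewrite upBE.
have M_ideal : idealr_closed M.
  split=> [||a x y /asboolP xM /asboolP yM]; first by apply/asboolP; case: Aid.
    exact/asboolP.
  by apply/asboolP; case: Aid => _; apply.
have M_prime : prime_idealr_closed M.
  move=> u v /asboolP uvM; apply: contraT.
  rewrite negb_or => /andP[/Mmax[m [a [mM E]]] /Mmax[m' [a' [mM' E']]]].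
  case: A1; have -> : 1 = (m' + a' * v) * m + a * u * m' + a * a' * (u * v).
    rewrite -[LHS]mulr1 {1}E E'; ring.
  by apply: is_idealD => //; [apply: is_idealD => //|]; apply: is_idealM.
pose MI := isIdealr.Build R M M_ideal.
pose MP := isPrimeIdealrClosed.Build R M M_prime.
pose P : prime_idealr R := HB.pack M MI MP.
by exists P => x Ix; apply/asboolP; right.
Qed.

End Krull.

Section FaithfullyFlat.
Variables (R : comNzRingType) (U : fppf_cover R).

(** If n is nonzero, its annihilator lies in a prime P.  By flatness R/Ann(n),
    which embeds in N, also dies after tensoring with each member.  But on a
    member with a prime Q above P, multiplication R/Ann(n) x U_j -> U_j/Q is
    bilinear and sends (1, 1) to 1, which is not in Q. *)
Lemma cover_faithful (N : lmodType R) (n : N) :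
  (forall j, tensor_eq0 [:: (n, 1 : U j)]) -> n = 0.
Proof.
move=> n0; apply: contrapT => nN0.
pose ann : {pred R^o} := fun a => `[< a *: n = 0 >].
have annZ (a x : R^o) : x \in ann -> a *: x \in ann.
  by move=> /asboolP xn; apply/asboolP; rewrite -scalerA xn scaler0.
have ann_zmod : zmod_closed ann.
  split=> [|x y /asboolP xn /asboolP yn]; apply/asboolP.
    exact: scale0r.
  by rewrite scalerBl xn yn subrr.
pose annM := GRing.isZmodClosed.Build R^o ann ann_zmod.
pose I : zmodClosed R^o := HB.pack ann annM.
have [|n1|P IP] := @exists_prime_above R (fun a => a *: n = 0).
- split=> [|a x y xn yn]; first exact: scale0r.
  by rewrite scalerDl -scalerA xn yn scaler0 addr0.
- by apply: nN0; rewrite -[n]scale1r.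
have [j [Q QP]] := cover_surj U P.
pose C := @quotient_module R R^o I annZ.
pose clC : {linear R^o -> C} := @to_quotient R R^o I annZ.
pose g (a : R^o) : N := a *: n.
have g_lin : linear g by move=> a x y; rewrite /g scalerDl scalerA.
pose f : {linear C -> N} := @quotient_lift R R^o I annZ N (linear_of g_lin)
  (fun x xI => asboolP _ xI).
have fE x : f (clC x) = x *: n by exact: quotient_liftE.
have f_inj : injective f.
  apply: raddf_inj => q; have [x ->] := to_quotient_surj q.
  by move=> xn; apply/to_quotient_eq0/asboolP; rewrite -fE.
have /(cover_flat f_inj) C0 :
    tensor_eq0 [seq (f x.1, x.2) | x <- [:: (clC 1, 1 : U j)]].
  by have := n0 j; rewrite -{1}[n]scale1r -fE.
have QZ (a : R) x : x \in (Q : {pred U j}) -> a *: x \in (Q : {pred U j}).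
  by move=> xQ; rewrite -mulr_algl; apply: idealMr.
pose D := @quotient_module R (U j) Q QZ.
pose clD : {linear U j -> D} := @to_quotient R (U j) Q QZ.
have h_lin (v : U j) : linear (fun a : R^o => clD (a *: v)).
  by move=> a x y; rewrite scalerDl linearD -scalerA linearZ.
have h0 v x : x \in I -> linear_of (h_lin v) x = 0.
  move=> /asboolP /IP xP; apply/to_quotient_eq0.
  by rewrite -mulr_algl mulrC; apply: idealMr; rewrite QP.
pose b (q : C) (v : U j) : D := @quotient_lift R R^o I annZ D _ (h0 v) q.
have bE x v : b (clC x) v = clD (x *: v) by exact: quotient_liftE.
have bl v : linear (b^~ v) by move=> a q q'; rewrite /b linearP.
have br q : linear (b q).
  move=> a v v'; have [x ->] := to_quotient_surj q.
  by rewrite !bE scalerDr linearD !scalerA mulrC -scalerA linearZ.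
have := C0 _ (bilinear_of bl br); rewrite big_seq1 /= bE scale1r.
by move=> /to_quotient_eq0; rewrite idealr1.
Qed.
End FaithfullyFlat.

(** * Descent along a covering *)
Section Descent.
Variables (R : comNzRingType) (U : fppf_cover R) (A : comAlgType R).

(** Apply faithful flatness to A as an R-module, with the coproducts of A and
    of the members of the covering as test algebras. *)
Lemma cover_separated (t : A) :
  (forall (T : comAlgType R) (f : {lrmorphism A -> T}) j
     (w : {lrmorphism U j -> T}), f t = 0) -> t = 0.
Proof.
move=> t0; apply: (@cover_faithful R U A) => j.
apply/tensor_sum_eq0; rewrite big_seq1 /=.
have [nz|/negPn/eqP z] := boolP (pure (1 : A) (1 : U j) != 0).
  exact: (t0 _ (tensor_inl nz) j (tensor_inr nz)).
exact: tensor_trivial.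
Qed.

Section Family.
Variable z : forall (T : comAlgType R), {lrmorphism A -> T} ->
  forall j, {lrmorphism U j -> T} -> T.
Hypothesis z_nat : forall (T T' : comAlgType R) (f : {lrmorphism T -> T'})
  (a : {lrmorphism A -> T}) j (w : {lrmorphism U j -> T}),
  z (f \o a) (f \o w) = f (z a w).
Hypothesis z_indep : forall (T : comAlgType R) (a : {lrmorphism A -> T}) j
  (w : {lrmorphism U j -> T}) k (w' : {lrmorphism U k -> T}), z a w = z a w'.

Local Notation M j := (tensor A (U j)).
Local Notation one j := (pure (1 : A) (1 : U j)).

(** The value of the family at the universal point, on the overlap of A with
    the member j; the overlap may be empty, which the condition nz excludes. *)
Let generic j : exists m : M j, forall nz : one j != 0,
  m = z (tensor_inl nz) (tensor_inr nz).
Proof.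
have [nz|z0] := pselect (one j != 0); last by exists 0 => nz; case: z0.
exists (z (tensor_inl nz) (tensor_inr nz)) => nz'.
by rewrite (Prop_irrelevance nz' nz).
Qed.

Let zz j : M j := sval (cid (generic j)).

Let zzE j (nz : one j != 0) : zz j = z (tensor_inl nz) (tensor_inr nz).
Proof. exact: (svalP (cid (generic j))). Qed.

Let zE (T : comAlgType R) (a : {lrmorphism A -> T}) j (w : {lrmorphism U j -> T})
  (nz : one j != 0) : z a w = tensor_copair nz a w (zz j).
Proof.
rewrite (zzE nz) -z_nat; congr (@z T _ j _); apply: lrmorph_eq => x.
- exact/esym/tensor_copairl.
- exact/esym/tensor_copairr.
Qed.

(** On the triple overlap of A with the members k and l, the universal values
    coming from k and from l coincide.  Writing the latter as a sum of pure
    tensors, this is an equality in the tensor product of M k and U l. *)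
Let zz_compat (P : lmodType R) k l (b : {bilinear M k -> U l -> P})
    (s : seq (A * U l)) :
  zz l = \sum_(x <- s) pure x.1 x.2 ->
  b (zz k) 1 = \sum_(x <- s) b (pure x.1 1) x.2.
Proof.
move=> sE; have [nz|/negPn/eqP z0] := boolP (one k != 0); last first.
  rewrite (tensor_trivial (zz k)) // linear0l big1 // => x _.
  by rewrite (tensor_trivial (pure _ _)) // linear0l.
pose B : comAlgType R := tensor_alg nz.
pose c : {bilinear B -> U l -> P} := b.
suff E : pure (zz k : B) (1 : U l) = \sum_(x <- s) pure (pure x.1 1 : B) x.2.
  have := congr1 (tensor_lift c) E.
  rewrite tensor_lift_pure linear_sum => ->.
  by apply: eq_bigr => x _; rewrite /= tensor_lift_pure.
have [nz'|/negPn/eqP z0] := boolP (pure (1 : B) (1 : U l) != 0); last first.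
  by apply/subr0_eq; apply: tensor_trivial.
pose u : {lrmorphism B -> tensor_alg nz'} := tensor_inl nz'.
pose v : {lrmorphism U l -> tensor_alg nz'} := tensor_inr nz'.
pose a : {lrmorphism A -> tensor_alg nz'} := u \o tensor_inl nz.
have nzl := tensor_nonzero a v.
transitivity (z a (u \o tensor_inr nz)); first by rewrite z_nat -zzE.
rewrite (z_indep _ _ v) (zE _ _ nzl) sE linear_sum.
by apply: eq_bigr => x _; rewrite /= tensor_copair_pure -tensor_inlrM.
Qed.

Let diag (a : A) : product_module (fun j => M j) := fun j => pure a 1.

Let diag_linear : linear diag.
Proof.
by move=> a x y; apply: functional_extensionality_dep => j; apply: pure_linearl.
Qed.

(** Let Q be the quotient of the product of the modules M j by the diagonal
    image of A.  By zz_compat, tensoring with a member makes the class of the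
    family zz equal to a sum of classes of elements of A, hence zero.  So this
    class is zero by faithful flatness, and the family comes from A. *)
Lemma cover_descent : exists t : A, forall (T : comAlgType R)
  (a : {lrmorphism A -> T}) j (w : {lrmorphism U j -> T}), z a w = a t.
Proof.
pose dg : {linear A -> product_module (fun j => M j)} := linear_of diag_linear.
(* S is the diagonal image of A *)
pose S : {pred product_module (fun j => M j)} := 
  fun x => `[< exists a, x = dg a >].
have S_zmod : zmod_closed S.
  split=> [|x y /asboolP[a ->] /asboolP[a' ->]]; apply/asboolP.
    by exists 0; rewrite linear0.
  by exists (a - a'); rewrite linearB.
have SZ (r : R) x : x \in S -> r *: x \in S.
  by move=> /asboolP[a ->]; apply/asboolP; exists (r *: a); rewrite linearZ.
pose SM := GRing.isZmodClosed.Build _ S S_zmod.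
pose I : zmodClosed (product_module (fun j => M j)) := HB.pack S SM.
pose cl : {linear _ -> @quotient_module R _ I SZ} := @to_quotient R _ I SZ.
have /to_quotient_eq0 /asboolP[t tE] : cl zz = 0.
  apply: (@cover_faithful R U) => l P b; rewrite big_seq1 /=.
  have [s sE] := tensor_sumP (zz l).
  have bl k y : linear (fun x : M k => b (cl (product_inj x)) y).
    by move=> r x x'; rewrite !linearP linearPl.
  have br k x : linear (fun y => b (cl (product_inj (x : M k))) y).
    by move=> r y y'; rewrite linearPr.
  rewrite (product_sum_inj zz) linear_sum linear_sumlz.
  have E k := zz_compat (bilinear_of (bl k) (br k)) sE.
  under eq_bigr => k _ do rewrite [b _ _]E.
  rewrite exchange_big big1 //= => x _.
  rewrite -linear_sumlz -linear_sum -(product_sum_inj (diag x.1)).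
  rewrite (_ : cl _ = 0) ?linear0l //.
  by apply/to_quotient_eq0/asboolP; exists x.1.
exists t => T a j w; have nz := tensor_nonzero a w.
by rewrite (zE _ _ nz) tE; apply: tensor_copairl.
Qed.

End Family.
End Descent.

Section MatrixInverse.
Variables (R : comNzRingType) (m : nat).

(** A choice of inverse, made total so that it can be used in formulas; it is
    natural in T on invertible matrices because inverses are unique. *)
Definition mxinv (T : comAlgType R) (g : 'M[T]_m) : 'M[T]_m :=
  if pselect (GL_points g) is left gGL then sval (cid gGL) else 1%:M.

Variables (T : comAlgType R) (g : 'M[T]_m).
Hypothesis gGL : GL_points g.

Lemma mulmxI : g *m mxinv g = 1%:M.
Proof. by rewrite /mxinv; case: pselect => // H; case: cid. Qed.

Lemma mulImx : mxinv g *m g = 1%:M.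
Proof. exact/mulmx1C/mulmxI. Qed.

Lemma mulmxIK p (h : 'M[T]_(p, m)) : h *m g *m mxinv g = h.
Proof. by rewrite -mulmxA mulmxI mulmx1. Qed.

Lemma mulmxIVK p (h : 'M[T]_(p, m)) : h *m mxinv g *m g = h.
Proof. by rewrite -mulmxA mulImx mulmx1. Qed.

Lemma mulIKmx p (h : 'M[T]_(m, p)) : mxinv g *m (g *m h) = h.
Proof. by rewrite mulmxA mulImx mul1mx. Qed.

Lemma mulIVKmx p (h : 'M[T]_(m, p)) : g *m (mxinv g *m h) = h.
Proof. by rewrite mulmxA mulmxI mul1mx. Qed.

Lemma mxinv_unique h : g *m h = 1%:M -> h = mxinv g.
Proof. by move=> gh; rewrite -[h]mulIKmx gh mulmx1. Qed.

Lemma mxinv_GL : GL_points (mxinv g).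
Proof. by exists g; apply: mulImx. Qed.

End MatrixInverse.

Lemma mxinv_map (R : comNzRingType) m (T T' : comAlgType R)
    (f : {lrmorphism T -> T'}) (g : 'M[T]_m) :
  GL_points g -> map_mx f (mxinv g) = mxinv (map_mx f g).
Proof.
move=> gGL; apply: (mxinv_unique (GL_map f gGL)).
by rewrite -map_mxM mulmxI // map_mx1.
Qed.

Section MatrixDescent.
Variables (R : comNzRingType) (U : fppf_cover R) (A : comAlgType R).

Lemma cover_separated_mx m n (X Y : 'M[A]_(m, n)) :
  (forall (T : comAlgType R) (f : {lrmorphism A -> T}) j
     (w : {lrmorphism U j -> T}), map_mx f X = map_mx f Y) -> X = Y.
Proof.
move=> E; apply/matrixP => i k; apply/subr0_eq.
apply: (@cover_separated R U) => T f j w; rewrite rmorphB /=.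
by have /matrixP/(_ i k) := E T f j w; rewrite !mxE => ->; rewrite subrr.
Qed.

Section Family.
Variables (m n : nat) (z : forall (T : comAlgType R), {lrmorphism A -> T} ->
  forall j, {lrmorphism U j -> T} -> 'M[T]_(m, n)).
Hypothesis z_nat : forall (T T' : comAlgType R) (f : {lrmorphism T -> T'})
  (a : {lrmorphism A -> T}) j (w : {lrmorphism U j -> T}),
  z (f \o a) (f \o w) = map_mx f (z a w).
Hypothesis z_indep : forall (T : comAlgType R) (a : {lrmorphism A -> T}) j
  (w : {lrmorphism U j -> T}) k (w' : {lrmorphism U k -> T}), z a w = z a w'.

Lemma cover_descent_mx : exists X : 'M[A]_(m, n), forall (T : comAlgType R)
  (a : {lrmorphism A -> T}) j (w : {lrmorphism U j -> T}), z a w = map_mx a X.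
Proof.
have H i k : exists t : A, forall (T : comAlgType R)
    (a : {lrmorphism A -> T}) j (w : {lrmorphism U j -> T}), z a w i k = a t.
  apply: (cover_descent (z := fun T a j w => z a w i k)).
  - by move=> T T' f a j w; rewrite z_nat mxE.
  - by move=> T a j w l w'; rewrite (z_indep a w w').
exists (\matrix_(i, k) sval (cid (H i k))) => T a j w.
by apply/matrixP => i k; rewrite !mxE; case: cid => t /= ->.
Qed.

End Family.

Section InvertibleFamily.
Variables (m : nat) (z : forall (T : comAlgType R), {lrmorphism A -> T} ->
  forall j, {lrmorphism U j -> T} -> 'M[T]_m).
Hypothesis z_nat : forall (T T' : comAlgType R) (f : {lrmorphism T -> T'})
  (a : {lrmorphism A -> T}) j (w : {lrmorphism U j -> T}),
  z (f \o a) (f \o w) = map_mx f (z a w).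
Hypothesis z_indep : forall (T : comAlgType R) (a : {lrmorphism A -> T}) j
  (w : {lrmorphism U j -> T}) k (w' : {lrmorphism U k -> T}), z a w = z a w'.
Hypothesis zGL : forall (T : comAlgType R) (a : {lrmorphism A -> T}) j
  (w : {lrmorphism U j -> T}), GL_points (z a w).

(** The inverses form a second family, which descends to the inverse. *)
Lemma cover_descent_GL : exists2 X : 'M[A]_m, GL_points X &
  forall (T : comAlgType R) (a : {lrmorphism A -> T}) j
    (w : {lrmorphism U j -> T}), z a w = map_mx a X.
Proof.
have [X XE] := cover_descent_mx z_nat z_indep.
have [||Y YE] := @cover_descent_mx m m (fun T a j w => mxinv (z a w)).
- by move=> T T' f a j w; rewrite z_nat mxinv_map.
- by move=> T a j w k w'; rewrite (z_indep a w w').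
exists X => //; exists Y; apply: cover_separated_mx => T f j w.
by rewrite map_mxM -(XE T f j w) -(YE T f j w) map_mx1 mulmxI.
Qed.

End InvertibleFamily.
End MatrixDescent.

Lemma mpoly_ev_map (R : comNzRingType) k (T T' : comAlgType R)
    (f : {lrmorphism T -> T'}) (a : 'I_k -> T) (a' : 'I_k -> T')
    (p : {mpoly R[k]}) :
  (forall i, f (a i) = a' i) -> f (mpoly_ev a p) = mpoly_ev a' p.
Proof.
move=> aE; rewrite /mpoly_ev /mmap rmorph_sum; apply: eq_bigr => mm _.
rewrite rmorphM /= linearZ /= rmorph1 /mmap1 rmorph_prod.
by congr (_ * _); apply: eq_bigr => i _; rewrite rmorphXn /= aE.
Qed.

Lemma mpoly_ev_map_mx (R : comNzRingType) m (T T' : comAlgType R)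
    (f : {lrmorphism T -> T'}) (g : 'M[T]_m) (p : {mpoly R[m * m]}) :
  f (mpoly_ev (mxvec g 0) p) = mpoly_ev (mxvec (map_mx f g) 0) p.
Proof. by apply: mpoly_ev_map => i; rewrite -map_mxvec mxE. Qed.

(** The equations of G hold as soon as they hold on the covering, by
    cover_separated. *)
Lemma closed_in_SL_local (R : comNzRingType) (U : fppf_cover R) m
    (G : subgroup_functor R m) (T : comAlgType R) (g : 'M[T]_m) :
  closed_in_SL G ->
  (forall (T' : comAlgType R) (f : {lrmorphism T -> T'}) j
     (w : {lrmorphism U j -> T'}), G T' (map_mx f g)) -> G T g.
Proof.
move=> [E GE] gG; apply/GE; split=> [|p Ep].
  apply/subr0_eq/(@cover_separated R U) => T' f j w.
  have /GE[det1 _] := gG T' f j w.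
  by rewrite rmorphB rmorph1 /= -det_map_mx det1 subrr.
apply: (@cover_separated R U) => T' f j w.
by have /GE[_ /(_ p Ep)] := gG T' f j w; rewrite -mpoly_ev_map_mx.
Qed.

(** * Conjugation of subgroup functors *)
Section StructureMap.
Variables (R : comNzRingType) (A : comAlgType R).

Definition structure_map (a : R^o) : A := a%:A.

Fact structure_map_linear : linear structure_map.
Proof. by move=> a x y; rewrite /structure_map scalerDl scalerA. Qed.
Fact structure_map_monoid : monoid_morphism structure_map.
Proof.
split=> [|x y]; first exact: scale1r.
by rewrite /structure_map -scalerAl mul1r scalerA.
Qed.

HB.instance Definition _ :=
  GRing.isLinear.Build R R^o A *:%R structure_map structure_map_linear.
HB.instance Definition _ :=
  GRing.isMonoidMorphism.Build R^o A structure_map structure_map_monoid.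

End StructureMap.

Section ConjugateBy.
Variables (R : comNzRingType) (m : nat).
Implicit Types (A B : comAlgType R) (F G H : subgroup_functor R m).

Lemma points_GL G (T : comAlgType R) (g : 'M[T]_m) : G T g -> GL_points g.
Proof. by move=> /pointsV[h _ gh]; exists h. Qed.

(** The subgroup G is x H x^-1 over A.  Keeping x explicit lets the conjugating
    matrices be composed. *)
Definition conj_by A H G (x : 'M[A]_m) : Prop :=
  forall (T : comAlgType R) (u : {lrmorphism A -> T}) (g : 'M[T]_m),
    G T g <-> exists2 h, H T h & g *m map_mx u x = map_mx u x *m h.

Lemma conj_by_map A B (f : {lrmorphism A -> B}) H G (x : 'M[A]_m) :
  conj_by H G x -> conj_by H G (map_mx f x).
Proof. by move=> xP T u g; rewrite -map_mx_comp -(xP T (u \o f)). Qed.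

Lemma conj_byM A F G H (x y : 'M[A]_m) : GL_points x ->
  conj_by G H x -> conj_by F G y -> conj_by F H (x *m y).
Proof.
move=> xGL xP yP T u g; have uxGL := GL_map u xGL; rewrite map_mxM.
split=> [/(xP T u)[h /(yP T u)[k Fk hk] gh]|[k Fk gk]].
  by exists k => //; rewrite mulmxA gh -!mulmxA hk.
pose h := map_mx u (mxinv x) *m g *m map_mx u x.
have hE : g *m map_mx u x = map_mx u x *m h.
  by rewrite /h mxinv_map // !mulmxA mulmxI // mul1mx.
apply/(xP T u); exists h => //; apply/(yP T u); exists k => //.
rewrite -[LHS](mulIKmx uxGL) (mulmxA _ h) -hE -mulmxA gk.
by rewrite -mulmxA mulIKmx.
Qed.

Lemma conj_byV A G H (x : 'M[A]_m) : GL_points x ->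
  conj_by G H x -> conj_by H G (mxinv x).
Proof.
move=> xGL xP T u g; have uxGL := GL_map u xGL; rewrite mxinv_map //.
split=> [Gg|[h /(xP T u)[k Gk hk] gh]].
  exists (map_mx u x *m g *m mxinv (map_mx u x)).
    by apply/(xP T u); exists g => //; rewrite mulmxIVK.
  by rewrite !mulmxA mulImx // mul1mx.
suff -> : g = k by [].
by rewrite -[RHS](mulIKmx uxGL) -hk mulmxA -gh mulmxIVK.
Qed.

Lemma normalizes_conj_by A H (x : 'M[A]_m) : GL_points x ->
  conj_by H H x -> normalizes H x.
Proof.
move=> xGL xP; split=> // T u g Hg; have uxGL := GL_map u xGL.
exists (map_mx u x *m g *m mxinv (map_mx u x)); last by rewrite mulmxIVK.
by apply/(xP T u); exists g => //; rewrite mulmxIVK.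
Qed.

Lemma conj_by_local (U : fppf_cover R) A G H (x : 'M[A]_m) :
  closed_in_SL G -> closed_in_SL H -> GL_points x ->
  (forall (T : comAlgType R) (u : {lrmorphism A -> T}) j
     (w : {lrmorphism U j -> T}), conj_by G H (map_mx u x)) ->
  conj_by G H x.
Proof.
move=> Gc Hc xGL xP T u g; have uxGL := GL_map u xGL.
have fuE (T' : comAlgType R) (f : {lrmorphism T -> T'}) :
    map_mx idfun (map_mx (f \o u) x) = map_mx f (map_mx u x).
  by apply/matrixP => i k; rewrite !mxE.
split=> [Hg|[h Gh gh]].
  exists (mxinv (map_mx u x) *m g *m map_mx u x); last first.
    by rewrite -!mulmxA mulIVKmx.
  apply: (closed_in_SL_local (U := U)) => // T' f j w.
  have [h Gh gh] := (xP T' (f \o u) j w T' idfun (map_mx f g)).1 (points_map f Hg).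
  rewrite fuE in gh.
  by rewrite map_mxM map_mxM mxinv_map // -mulmxA gh mulIKmx //; apply: GL_map.
apply: (closed_in_SL_local (U := U)) => // T' f j w.
apply: (xP T' (f \o u) j w T' idfun (map_mx f g)).2.
exists (map_mx f h); first exact: points_map.
by rewrite fuE -!map_mxM gh.
Qed.

End ConjugateBy.

Lemma normalizer_conj_by (R : comNzRingType) n (A : comAlgType R) (x : 'M[A]_2) :
  normalizer_mu R n A x -> conj_by (mu R n) (mu R n) x.
Proof.
move=> xN; have [xGL xP] := xN.
have [y yN xy] := normalizerV xN; have [_ yP] := yN.
move=> T u g; have uyx : map_mx u y *m map_mx u x = 1%:M.
  by rewrite -map_mxM (mulmx1C xy) map_mx1.
have uxy : map_mx u x *m map_mx u y = 1%:M by rewrite -map_mxM xy map_mx1.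
split=> [/(yP T u)[h Hh E]|[h /(xP T u)[k Hk E] gh]].
  exists h => //; rewrite -[LHS]mul1mx -uxy -mulmxA; congr (_ *m _).
  by rewrite mulmxA -E -mulmxA uyx mulmx1.
suff -> : g = k by [].
by rewrite -[g]mulmx1 -uxy mulmxA gh -E -mulmxA uxy mulmx1.
Qed.

(** * Frames of a cocycle *)
Lemma choice_dep (I : Type) (X : I -> Type) (P : forall i, X i -> Prop) :
  (forall i, exists x, P i x) -> exists x, forall i, P i (x i).
Proof.
by move=> H; exists (fun i => sval (cid (H i))) => i; apply: (svalP (cid _)).
Qed.

Lemma quot_piP (T : Type) (r : T -> T -> Prop) (x y : T) :
  quot_pi r x = quot_pi r y <-> eqv_class r x y.
Proof.
split=> [/(congr1 sval) /= ->|xy]; first exact: rst_refl.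
apply: eq_exist; apply/funext => z; apply/propext; split=> [xz|].
  exact: rst_trans (rst_sym _ _ _ _ xy) xz.
exact: rst_trans xy.
Qed.

Section Frames.
Variables (R : comNzRingType) (m : nat).
Implicit Types (G : subgroup_functor R m) (U V : fppf_cover R).

(** The condition says that c is x_i^-1 x_j on the overlaps, without forming
    inverses; so c is split by x in GL_m. *)
Definition frame U G (c : cocycle U G) (x : forall i, 'M[U i]_m) : Prop :=
  (forall i, GL_points (x i)) /\
  forall i j (T : comAlgType R) (u : {lrmorphism U i -> T})
    (v : {lrmorphism U j -> T}),
    map_mx u (x i) *m c i j T u v = map_mx v (x j).

Lemma frame_push U V G (c : cocycle U G) (d : cocycle V G) x
    (r : refinement U V)
    (h : forall j, 'M[V j]_m) :
  frame c x -> (forall j, G (V j) (h j)) ->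
  (forall i j (T : comAlgType R)
     (u : {lrmorphism V i -> T}) (v : {lrmorphism V j -> T}),
     map_mx u (h i) *m d i j T u v =
     coc_restr r c i j T u v *m map_mx v (h j)) ->
  frame d (fun j => map_mx (ref_map r j) (x (ref_idx r j)) *m h j).
Proof.
move=> [xGL xc] hG cd; split=> [j|i j T u v].
  by apply: GLM; [apply: GL_map | apply: points_GL (hG j)].
rewrite !map_mxM -mulmxA cd mulmxA; congr (_ *m _).
rewrite -!map_mx_comp.
exact: (xc _ _ _ (u \o ref_map r i) (v \o ref_map r j)).
Qed.

(** If y is a frame on the finer covering V and h the cochain relating c to d,
    then y h^-1 is a frame xi of the restriction of c to V.  Its translate
    xi_k c_(k,i) on the overlap of U_i with V_k does not depend on k, so it
    descends to U_i; this gives the member of index i of a frame of c. *)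
Lemma frame_pull U V G (c : cocycle U G) (d : cocycle V G) y
    (r : refinement U V) :
  frame d y -> cohomologous (coc_restr r c) d -> exists x, frame c x.
Proof.
move=> [yGL yd] [h hG cd].
pose xi (T : comAlgType R) k (w : {lrmorphism V k -> T}) : 'M[T]_m :=
  map_mx w (y k *m mxinv (h k)).
have hGL k : GL_points (h k) := points_GL (hG k).
have xi_GL (T : comAlgType R) k (w : {lrmorphism V k -> T}) : GL_points (xi T k w).
  by apply/GL_map/GLM => //; apply: mxinv_GL.
have xi_c (T : comAlgType R) k l (w : {lrmorphism V k -> T})
    (w' : {lrmorphism V l -> T}) :
    xi T k w *m c _ _ T (w \o ref_map r k) (w' \o ref_map r l) = xi T l w'.
  have wGL := GL_map w (hGL k); have wGL' := GL_map w' (hGL l).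
  rewrite /xi !map_mxM !mxinv_map // -(yd _ _ _ w w') -[LHS](mulmxIK wGL').
  congr (_ *m _); rewrite -!mulmxA; congr (_ *m _).
  by have /= <- := cd _ _ _ w w'; rewrite mulIKmx.
have H i : exists2 X : 'M[U i]_m, GL_points X & forall (T : comAlgType R)
    (a : {lrmorphism U i -> T}) k (w : {lrmorphism V k -> T}),
    xi T k w *m c _ _ T (w \o ref_map r k) a = map_mx a X.
  apply: (cover_descent_GL (z := fun T a k w =>
    xi T k w *m c _ _ T (w \o ref_map r k) a))
    => [T T' f a k w|T a k w l w'|T a k w].
  - rewrite map_mxM -(coc_nat c) /xi -map_mx_comp; congr (_ *m c _ _ _ _ _).
    exact: lrmorph_eq.
  - by rewrite -(xi_c _ _ _ w' w) -mulmxA (coc_mul c).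
  - by apply: GLM => //; apply: points_GL (coc_in c _ _).
have /choice_dep[x xP] : forall i, exists X : 'M[U i]_m, GL_points X /\
    forall (T : comAlgType R) (a : {lrmorphism U i -> T}) k
      (w : {lrmorphism V k -> T}),
    xi T k w *m c _ _ T (w \o ref_map r k) a = map_mx a X.
  by move=> i; have [X ? ?] := H i; exists X.
exists x; split=> [i|i j T u v]; first by case: (xP i).
apply: (cover_separated_mx (U := V)) => T' f k w.
rewrite map_mxM -(coc_nat c) -!map_mx_comp.
have [_ xi_i] := xP i; have [_ xi_j] := xP j.
by rewrite -(xi_i T' (f \o u) k w) -(xi_j T' (f \o v) k w) -mulmxA (coc_mul c).
Qed.

Definition framed G (c : coc_on_cover G) : Prop := exists x, frame (tagged c) x.

Lemma framed_step G (c d : coc_on_cover G) :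
  coc_step c d -> framed c <-> framed d.
Proof.
move=> [r cd]; split=> [[x xc]|[y yd]]; last exact: frame_pull yd cd.
case: cd => h hG cd.
exists (fun j => map_mx (ref_map r j) (x (ref_idx r j)) *m h j).
exact: frame_push cd.
Qed.

Definition to_cover U : refinement (trivial_cover R) U :=
  @Refinement R (trivial_cover R) U (fun=> tt)
    (fun j => @structure_map R (U j) : {lrmorphism R^o -> U j}).

(** Cohomologous to the trivial cocycle on a covering means having a frame
    there, and frames are carried both ways along refinements. *)
Lemma framed_GL_base (c : coc_on_cover (GL R m)) :
  quot_pi (@coc_step R m (GL R m)) c = H1_base (GL R m) <-> framed c.
Proof.
split=> [/quot_piP E|[x [xGL xc]]].
  suff /(_ _ _ E) -> : forall d d' : coc_on_cover (GL R m),
      eqv_class (@coc_step R m (GL R m)) d d' -> framed d <-> framed d'.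
    exists (fun=> 1%:M); split=> [i|i j T u v]; first exact: GL1.
    by rewrite !map_mx1 mulmx1.
  move=> d d'; elim=> {d d' E} [d d'|d|d d' _ dd'|d1 d2 d3 _ d12 _ d23].
  - exact: framed_step.
  - by [].
  - by split=> /dd'.
  - by rewrite d12.
apply/esym/quot_piP; apply: rst_step; exists (to_cover _); exists x => // i j T u v.
by rewrite mul1mx xc.
Qed.

End Frames.

(** * Conjugates of mu_n *)
Section RootOfUnity.
Variables (R : comNzRingType) (n : nat).
Hypothesis n_gt2 : (2 < n)%N.

Local Notation XnB1 := ('X^n - 1%:P : {poly R}).
Local Notation C := ({poly %/ XnB1}).

Let n_gt0 : (0 < n)%N. Proof. exact: leq_trans n_gt2. Qed.
Let mk_monicE : mk_monic XnB1 = XnB1.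
Proof. by rewrite /mk_monic size_XnsubC // monicXnsubC // ltnS n_gt0. Qed.

Let root : C := in_qpoly XnB1 'X.

Let root_expn : root ^+ n = 1.
Proof.
rewrite -rmorphXn -(rmorph1 (in_qpoly XnB1)) /=; apply/subr0_eq.
rewrite -rmorphB; apply: val_inj; rewrite /= mk_monicE -polyC1.
by apply: Pdiv.RingMonic.rmodpp; apply: monicXnsubC.
Qed.

Let coefX k : (k < n)%N -> forall i, (root ^+ k : {poly R})`_i = (i == k)%:R.
Proof.
move=> kn i; rewrite -rmorphXn /= Pdiv.Ring.rmodp_small ?coefXn //.
by rewrite size_polyXn mk_monicE size_XnsubC.
Qed.

(** In R[X]/(X^n - 1) the class u of X has inverse X^(n-1), and u - u^-1 has
    coefficient 1 at X because n > 2.  Extracting this coefficient shows that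
    u - u^-1 is a nonzerodivisor over A. *)
Lemma adjoin_root_of_unity (A : comAlgType R) :
  exists (T : comAlgType R) (f : {lrmorphism A -> T}) (u v : T),
    [/\ u ^+ n = 1, u * v = 1 & forall a, f a * (u - v) = 0 -> a = 0].
Proof.
have bl i (q : C) : linear (fun a : A => (q : {poly R})`_i *: a).
  by move=> r a a'; rewrite scalerDr !scalerA mulrC.
have br i (a : A) : linear (fun q : C => (q : {poly R})`_i *: a).
  by move=> r q q'; rewrite poly_of_qpolyD poly_of_qpolyZ coefD coefZ scalerDl scalerA.
pose b i : {bilinear A -> C -> A} := bilinear_of (bl i) (br i).
have nz : pure (1 : A) (1 : C) != 0.
  apply/eqP => /(congr1 (tensor_lift (b 0%N))); rewrite tensor_lift_pure linear0.
  change (((1 : C) : {poly R})`_0 *: (1 : A) = 0 -> False).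
  have := coefX n_gt0 0%N; rewrite expr0 => ->.
  by rewrite scale1r => /eqP; rewrite oner_eq0.
exists (tensor_alg nz), (tensor_inl nz), (tensor_inr nz root).
exists (tensor_inr nz (root ^+ n.-1)); split=> [||a].
- by rewrite -rmorphXn root_expn; apply: rmorph1.
- by rewrite -rmorphM -exprS prednK // root_expn; apply: rmorph1.
rewrite -rmorphB /= tensor_inlrM => /(congr1 (tensor_lift (b 1%N))).
rewrite tensor_lift_pure linear0.
change (((root : {poly R}) - (root ^+ n.-1 : {poly R}))`_1 *: a = 0 -> a = 0).
rewrite coefB; have := coefX (ltn_trans (ltnSn 1) n_gt2) 1%N; rewrite expr1 => ->.
rewrite coefX ?ltn_predL //; have /negPf -> : 1%N != n.-1.
  by case: (n) n_gt2 => [|[|[|k]]].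
by rewrite subr0 scale1r.
Qed.

End RootOfUnity.

Section TwoByTwo.
Variable T : comNzRingType.
Implicit Types g h x : 'M[T]_2.

Lemma ord2P (i : 'I_2) : i = 0 \/ i = 1.
Proof. by case: i => [[|[|//]] i2]; [left | right]; apply: val_inj. Qed.

Lemma mulmx2E g h i j : (g *m h) i j = g i 0 * h 0 j + g i 1 * h 1 j.
Proof.
rewrite mxE !big_ord_recl big_ord0 addr0.
by congr (_ * _ + g _ _ * h _ _); apply: val_inj.
Qed.

Lemma mx2P g h : g 0 0 = h 0 0 -> g 0 1 = h 0 1 -> g 1 0 = h 1 0 ->
  g 1 1 = h 1 1 -> g = h.
Proof.
by move=> *; apply/matrixP => i j; case: (ord2P i) => ->; case: (ord2P j) => ->.
Qed.

Lemma mx2_inv_eqs g h : g *m h = 1%:M ->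
  [/\ g 0 0 * h 0 0 + g 0 1 * h 1 0 = 1, g 0 0 * h 0 1 + g 0 1 * h 1 1 = 0,
      g 1 0 * h 0 0 + g 1 1 * h 1 0 = 0 & g 1 0 * h 0 1 + g 1 1 * h 1 1 = 1].
Proof. by move=> gh; split; rewrite -mulmx2E gh !mxE. Qed.

Lemma det_mx2 g : \det g = g 0 0 * g 1 1 - g 0 1 * g 1 0.
Proof.
rewrite (expand_det_row _ 0) !big_ord_recl big_ord0 addr0 /cofactor !det_mx11.
rewrite !mxE /= expr0 mul1r expr1 mulN1r mulrN.
by congr (g _ _ * g _ _ - g _ _ * g _ _); apply: val_inj.
Qed.

End TwoByTwo.

Lemma diag2E (R : comNzRingType) (T : comAlgType R) (u v : T) :
  [/\ diag2 u v 0 0 = u, diag2 u v 0 1 = 0, diag2 u v 1 0 = 0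
    & diag2 u v 1 1 = v].
Proof. by split; rewrite !mxE. Qed.

Section Diagonal.
Variables (R : comNzRingType) (T : comAlgType R).
Implicit Types g h x : 'M[T]_2.

Lemma map_diag2 (T' : comAlgType R) (f : {lrmorphism T -> T'}) (u v : T) :
  map_mx f (diag2 u v) = diag2 (f u) (f v).
Proof.
have [a b c d] := diag2E u v; have [a' b' c' d'] := diag2E (f u) (f v).
by apply: mx2P; rewrite mxE ?a ?b ?c ?d ?a' ?b' ?c' ?d' ?rmorph0.
Qed.

Lemma diag2X (u v : T) k : diag2 u v ^+ k = diag2 (u ^+ k) (v ^+ k).
Proof.
elim: k => [|k IH]; first by rewrite !expr0 diag2_1.
by rewrite exprS IH -mulmxE diag2M -!exprS.
Qed.

Lemma comm_diag2_10 h :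
  h *m diag2 1 0 = diag2 1 0 *m h <-> h = diag2 (h 0 0) (h 1 1).
Proof.
have [a b c d] := diag2E (1 : T) 0.
have [a' b' c' d'] := diag2E (h 0 0) (h 1 1); split=> [E|->].
  have E01 := congr1 (fun M : 'M__ => M 0 1) E.
  have E10 := congr1 (fun M : 'M__ => M 1 0) E.
  rewrite !mulmx2E ?a ?b ?c ?d !(mulr0, mul0r, mulr1, mul1r, addr0, add0r) in E01 E10.
  by apply: mx2P; rewrite ?a' ?b' ?c' ?d'.
by rewrite !diag2M !mulr1 !mul1r mulr0 mul0r.
Qed.

Lemma conj_expn g x h k : g *m x = x *m h -> g ^+ k *m x = x *m h ^+ k.
Proof.
move=> gh; elim: k => [|k IH]; first by rewrite !expr0 mulmx1 mul1mx.
by rewrite !exprS -!mulmxE -mulmxA IH mulmxA gh -mulmxA.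
Qed.

Lemma comm_conj x g h : GL_points x ->
  mxinv x *m g *m x *m h = h *m (mxinv x *m g *m x) <->
  g *m (x *m h *m mxinv x) = x *m h *m mxinv x *m g.
Proof.
move=> xGL; split=> E.
  have /(congr1 (fun M => x *m M *m mxinv x)) := E.
  by rewrite !mulmxA mulmxI // mul1mx mulmxIK.
have /(congr1 (fun M => mxinv x *m M *m x)) := E.
rewrite !mulmxA mulImx // mul1mx => <-.
by rewrite mulmxIVK.
Qed.

(** Commuting with diag(1,0) characterises diagonal matrices in every
    characteristic, so mu_n is the set of matrices of determinant 1 and n-th
    power 1 with this property, which makes sense after conjugation. *)
Lemma mu_conjP n x g : GL_points x ->
  (exists2 h, mu R n T h & g *m x = x *m h) <->
  [/\ \det g = 1, g ^+ n = 1 &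
      g *m (x *m diag2 1 0 *m mxinv x) = x *m diag2 1 0 *m mxinv x *m g].
Proof.
move=> xGL; split=> [[h [u [v [un uv hE]]] gh]|[det_g gn gc]].
  have gE : g = x *m h *m mxinv x by rewrite -gh mulmxIK.
  split.
  - have := congr1 determinant gE; rewrite !det_mulmx mulrAC -det_mulmx.
    rewrite mulmxI // det1 mul1r hE => ->; rewrite det_mx2.
    by have [-> -> _ ->] := diag2E u v; rewrite mul0r subr0.
  - have := conj_expn n gh; rewrite hE diag2X un (exprn_inv un uv) diag2_1.
    by rewrite mulmx1 => E; rewrite -[LHS](mulmxIK xGL) E mulmxI.
  - apply/(comm_conj _ _ xGL)/comm_diag2_10.
    rewrite -!mulmxA gh mulIKmx // hE.
    by have [-> _ _ ->] := diag2E u v.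
pose h := mxinv x *m g *m x.
have gh : g *m x = x *m h by rewrite /h -!mulmxA mulIVKmx.
exists h => //; move/(comm_conj _ _ xGL)/comm_diag2_10: gc; rewrite -/h => hE.
have hn : h ^+ n = 1.
  by rewrite -[LHS](mulIKmx xGL) -(conj_expn n gh) gn mul1mx mulImx.
have det_h : \det h = 1.
  by rewrite /h !det_mulmx mulrAC -det_mulmx mulImx // det1 mul1r.
clearbody h; exists (h 0 0), (h 1 1); split=> //.
  have := congr1 (fun M : 'M__ => M 0 0) hn; rewrite {1}hE diag2X.
  by have [-> _ _ _] := diag2E (h 0 0 ^+ n) (h 1 1 ^+ n); rewrite mxE eqxx.
have h01 : h 0 1 = 0 by rewrite hE; have [] := diag2E (h 0 0) (h 1 1).
by move: det_h; rewrite det_mx2 h01 mul0r subr0.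
Qed.

End Diagonal.

Section Splitting.
Variables (R : comNzRingType) (T : comAlgType R).
Implicit Types x e g : 'M[T]_2.

(** An idempotent e of trace 1 and its complement 1 - e have opposite images.
    This is also true of 2 e - 1, but the latter need not determine the
    commutant of e where 2 is not invertible. *)
Definition modulo_scalar e : 'M[T]_2 := e - (e 0 0)%:M.

Lemma modulo_scalarE e :
  [/\ modulo_scalar e 0 0 = 0, modulo_scalar e 0 1 = e 0 1, modulo_scalar e 1 0 = e 1 0
    & modulo_scalar e 1 1 = e 1 1 - e 0 0].
Proof. by split; rewrite !mxE ?eqxx ?mulr1n ?mulr0n ?subrr ?subr0. Qed.

Lemma modulo_scalar_affine a b e : modulo_scalar (a *: e + b%:M) = a *: modulo_scalar e.
Proof.
apply/matrixP => i j; rewrite !mxE eqxx.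
by case: (i == j); rewrite ?mulr1n ?mulr0n; ring.
Qed.

Lemma comm_modulo_scalar g e :
  g *m modulo_scalar e = modulo_scalar e *m g <-> g *m e = e *m g.
Proof.
rewrite /modulo_scalar mulmxBr mulmxBl scalar_mxC; split=> [/addIr //|->] //.
Qed.

Definition split_proj x : 'M[T]_2 := x *m diag2 1 0 *m mxinv x.
Definition split_coord x : 'M[T]_2 := modulo_scalar (split_proj x).

(** The projector e has trace 1 and determinant 0, so
    (e_11 - e_00)^2 + 4 e_10 e_01 = (e_00 + e_11)^2 = 1. *)
Lemma split_coord_unit x : GL_points x ->
  split_coord x 1 1 * split_coord x 1 1
  + 4%:R * (split_coord x 1 0 * split_coord x 0 1) = 1.
Proof.
move=> xGL; have [_ -> -> ->] := modulo_scalarE (split_proj x).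
have [a b c d] := diag2E (1 : T) 0.
rewrite /split_proj !mulmx2E a b c d !(mulr0, mulr1, mul0r, mul1r, addr0, add0r).
have [E _ _ _] := mx2_inv_eqs (mulImx xGL).
have -> : forall p q r s : T, (r * q - p * s) * (r * q - p * s) +
    4 * (r * s * (p * q)) = (s * p + q * r) ^+ 2 by move=> *; ring.
by rewrite E expr1n.
Qed.

(** The coordinates generate the unit ideal, by split_coord_unit. *)
Lemma comm_split_coord g x : GL_points x ->
  (forall k l, g *m (split_coord x k l *: split_coord x) =
               split_coord x k l *: split_coord x *m g) <->
  g *m split_proj x = split_proj x *m g.
Proof.
move=> xGL; rewrite -comm_modulo_scalar -/(split_coord x); split=> [E|E k l].
  rewrite -[split_coord x in LHS]scale1r -[split_coord x in RHS]scale1r.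
  rewrite -(split_coord_unit xGL) scalerDl -scalerA mulrA -!scalerA.
  rewrite mulmxDr mulmxDl -!scalemxAr -!scalemxAl; congr (_ *: _ + _ *: (_ *: _)).
    by have := E 1 1; rewrite -scalemxAr -scalemxAl.
  by have := E 0 1; rewrite -scalemxAr -scalemxAl.
by rewrite -scalemxAr E scalemxAl.
Qed.

End Splitting.

Lemma map_split_coord (R : comNzRingType) (T T' : comAlgType R)
    (f : {lrmorphism T -> T'}) (x : 'M[T]_2) :
  GL_points x -> map_mx f (split_coord x) = split_coord (map_mx f x).
Proof.
move=> xGL; rewrite /split_coord /modulo_scalar /split_proj.
rewrite -mxinv_map // -[diag2 1 0 in RHS](_ : map_mx f (diag2 1 0) = _).
  by rewrite -!map_mxM raddfB /= map_scalar_mx !mxE.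
by rewrite map_diag2 rmorph1 rmorph0.
Qed.

Section Twist.
Variables (R : comNzRingType) (n : nat).
Hypothesis n_gt2 : (2 < n)%N.

(** Conjugate diag(u, u^-1) for a generic n-th root of unity u.  Since the
    result is diagonal, each row of c satisfies c_i0 c_i1 (u - u^-1) = 0. *)
Lemma normalizer_monomial (A : comAlgType R) (c : 'M[A]_2) :
  normalizer_mu R n A c -> c 0 0 * c 0 1 = 0 /\ c 1 0 * c 1 1 = 0.
Proof.
case=> _ cN; have [T [f [u [v [un uv uvP]]]]] := adjoin_root_of_unity n_gt2 A.
have Hh : mu R n T (diag2 u v) by exists u, v.
have [_ [u' [v' [_ _ ->]]] E] := cN T f _ Hh.
have E00 := congr1 (fun M : 'M__ => M 0 0) E.
have E01 := congr1 (fun M : 'M__ => M 0 1) E.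
have E10 := congr1 (fun M : 'M__ => M 1 0) E.
have E11 := congr1 (fun M : 'M__ => M 1 1) E.
have [a b c' d] := diag2E u v; have [a' b' c'' d'] := diag2E u' v'.
rewrite !mulmx2E ?a ?b ?c' ?d ?a' ?b' ?c'' ?d' in E00 E01 E10 E11.
rewrite !mxE !(mulr0, mul0r, addr0, add0r) in E00 E01 E10 E11.
split; apply: uvP; rewrite rmorphM.
  transitivity (f (c 0 1) * (f (c 0 0) * u) - f (c 0 0) * (f (c 0 1) * v)).
    by ring.
  by rewrite -E00 -E01; ring.
transitivity (f (c 1 1) * (f (c 1 0) * u) - f (c 1 0) * (f (c 1 1) * v)).
  by ring.
by rewrite -E10 -E11; ring.
Qed.

(** The off-diagonal entries of c diag(1,0) c^-1 are multiples of c_00 c_01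
    and c_10 c_11, and this matrix is idempotent of trace 1. *)
Lemma normalizer_split_proj (A : comAlgType R) (c : 'M[A]_2) :
  normalizer_mu R n A c -> exists2 t : A, t * t = t &
  split_proj c = diag2 t (1 - t).
Proof.
move=> cN; have [cGL _] := cN; have [ab cd] := normalizer_monomial cN.
have [e1 e2 e3 e4] := mx2_inv_eqs (mulmxI cGL).
have [i1 i2 i3 i4] := mx2_inv_eqs (mulImx cGL).
have [a b c' d] := diag2E (1 : A) 0.
have P i j : split_proj c i j = c i 0 * mxinv c 0 j.
  rewrite /split_proj mulmx2E !mulmx2E a b c' d.
  by rewrite !(mulr0, mul0r, addr0, add0r, mulr1).
move: ab cd e1 e2 e3 e4 i1 i2 i3 i4 P.
move: (mxinv c) => c''; set p := c'' 0 0; set q := c'' 0 1; set r := c'' 1 0.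
set s := c'' 1 1; set a0 := c 0 0; set b0 := c 0 1; set c0 := c 1 0.
set d0 := c 1 1.
move=> ab cd e1 e2 e3 e4 i1 i2 i3 i4 P.
have aq : a0 * q = 0.
  (* c^-1 is the adjugate of c times the determinant of c^-1 *)
  have -> : q = - (p * s - q * r) * b0.
    transitivity (q * 1 - p * 0); first by ring.
    by rewrite -{1}e1 -e2; ring.
  by rewrite mulrCA ab mulr0.
have cp : c0 * p = 0.
  have -> : p = (p * s - q * r) * d0.
    transitivity (p * 1 - r * 0); first by ring.
    by rewrite -{1}i4 -i2; ring.
  by rewrite mulrCA cd mulr0.
have cq : c0 * q = 1 - a0 * p by rewrite -i1; ring.
exists (a0 * p); last first.
  have [a' b' c1 d'] := diag2E (a0 * p) (1 - a0 * p).
  by apply: mx2P; rewrite ?a' ?b' ?c1 ?d' P.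
rewrite -[RHS]mulr1 -i1 mulrDr [in RHS](_ : a0 * p * (q * c0) = a0 * q * (c0 * p)).
  by rewrite cp mulr0 addr0 (mulrC p).
by ring.
Qed.

(** With t as above, diag(t, 1 - t) = (2t - 1) diag(1,0) + (1 - t), and
    (2t - 1)^2 = 1 since t is idempotent. *)
Lemma split_coord_twist (A : comAlgType R) (x c : 'M[A]_2) :
  GL_points x -> normalizer_mu R n A c ->
  exists2 d : A, d * d = 1 & split_coord (x *m c) = d *: split_coord x.
Proof.
move=> xGL cN; have [cGL _] := cN.
have [t tt ct] := normalizer_split_proj cN.
(* 2t - 1 is the difference of the two complementary idempotents *)
exists (2%:R * t - 1).
  have -> : (2%:R * t - 1) * (2%:R * t - 1) = 4%:R * (t * t - t) + 1 by ring.
  by rewrite tt subrr mulr0 add0r.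
rewrite /split_coord -(modulo_scalar_affine _ (1 - t)); congr modulo_scalar.
rewrite /split_proj.
have -> : mxinv (x *m c) = mxinv c *m mxinv x.
  symmetry; apply: mxinv_unique; first exact: GLM.
  by rewrite mulmxA mulmxIK // mulmxI.
have -> : x *m c *m diag2 1 0 *m (mxinv c *m mxinv x) =
    x *m split_proj c *m mxinv x.
  by rewrite /split_proj !mulmxA.
rewrite ct (_ : diag2 t (1 - t) = (2%:R * t - 1) *: diag2 1 0 + (1 - t)%:M).
  rewrite mulmxDr mulmxDl -scalemxAr -scalemxAl; congr (_ + _).
  by rewrite scalar_mxC -mulmxA mulmxI // mulmx1.
have [a b c' d] := diag2E t (1 - t); have [a' b' c'' d'] := diag2E (1 : A) 0.
apply: mx2P; rewrite ?a ?b ?c' ?d mxE [X in _ = X + _]mxE ?a' ?b' ?c'' ?d' mxE /=;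
  by rewrite ?mulr1n ?mulr0n; ring.
Qed.

Lemma split_coord_twist_mul (A : comAlgType R) (x c : 'M[A]_2) k l :
  GL_points x -> normalizer_mu R n A c ->
  split_coord (x *m c) k l *: split_coord (x *m c) =
  split_coord x k l *: split_coord x.
Proof.
move=> xGL cN; have [d dd ->] := split_coord_twist xGL cN.
by rewrite mxE scalerA mulrAC dd mul1r.
Qed.

End Twist.

(** * The form attached to a frame *)
Section FormOfFrame.
Variables (R : comNzRingType) (n : nat) (U : fppf_cover R).
Variable x : forall i, 'M[U i]_2.

(** The points that lie in x_i mu_n x_i^-1 wherever U_i has a point.  Being
    stable under products is then clear, while the equations over R are found
    afterwards. *)
Definition frame_points (T : comAlgType R) (g : 'M[T]_2) : Prop :=
  \det g = 1 /\
  forall (T' : comAlgType R) (f : {lrmorphism T -> T'}) i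
    (u : {lrmorphism U i -> T'}),
    exists2 h, mu R n T' h & map_mx f g *m map_mx u (x i) = map_mx u (x i) *m h.

Fact frame_points_map (T T' : comAlgType R) (f : {lrmorphism T -> T'})
  (g : 'M[T]_2) : frame_points g -> frame_points (map_mx f g).
Proof.
case=> det_g gP; split=> [|T'' f' i u]; first by rewrite det_map_mx det_g rmorph1.
by rewrite -map_mx_comp; apply: (gP T'' (f' \o f) i u).
Qed.

Fact frame_points1 (T : comAlgType R) : frame_points (1%:M : 'M[T]_2).
Proof.
split=> [|T' f i u]; first exact: det1.
by exists 1%:M; [apply: points1 | rewrite map_mx1 mul1mx mulmx1].
Qed.

Fact frame_pointsM (T : comAlgType R) (g h : 'M[T]_2) :
  frame_points g -> frame_points h -> frame_points (g *m h).
Proof.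
move=> [det_g gP] [det_h hP]; split=> [|T' f i u].
  by rewrite det_mulmx det_g det_h mulr1.
have [k kmu gk] := gP T' f i u; have [l lmu hl] := hP T' f i u.
by exists (k *m l); [apply: pointsM | rewrite map_mxM -mulmxA hl mulmxA gk mulmxA].
Qed.

Fact frame_pointsV (T : comAlgType R) (g : 'M[T]_2) :
  frame_points g -> exists2 h, frame_points h & g *m h = 1%:M.
Proof.
move=> [det_g gP].
have gGL : GL_points g by exists (\adj g); rewrite mul_mx_adj det_g.
exists (mxinv g); last exact: mulmxI; split=> [|T' f i u].
  by rewrite -[LHS]mul1r -det_g -det_mulmx mulmxI // det1.
have [k kmu gk] := gP T' f i u; have [l lmu kl] := pointsV kmu.
exists l => //; have fgGL := GL_map f gGL; rewrite mxinv_map //.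
by rewrite -[RHS](mulIKmx fgGL) (mulmxA _ _ l) gk -mulmxA kl mulmx1.
Qed.

Definition frame_functor : subgroup_functor R 2 :=
  SubgroupFunctor frame_points_map frame_points1 frame_pointsM frame_pointsV.

(** The equations are the entries of X^n - 1 and of X M - M X, where X is the
    generic matrix.  They hold on all points because they hold on the
    covering. *)
Lemma frame_functor_closed (S : 'M[R^o]_2 -> Prop) :
  (forall i (T : comAlgType R) (u : {lrmorphism U i -> T}) (g : 'M[T]_2),
     \det g = 1 ->
     (exists2 h, mu R n T h & g *m map_mx u (x i) = map_mx u (x i) *m h) <->
     g ^+ n = 1 /\ forall M, S M ->
       g *m map_mx (structure_map T) M = map_mx (structure_map T) M *m g) ->
  closed_in_SL frame_functor.
Proof.
move=> SP; pose X : 'M[{mpoly R[2 * 2]}]_2 := vec_mx (\row_k 'X_k).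
pose K (M : 'M[R^o]_2) : 'M[{mpoly R[2 * 2]}]_2 := map_mx (fun a : R => a%:MP) M.
pose E p := exists i j, p = (X ^+ n - 1) i j \/
  exists2 M, S M & p = (X *m K M - K M *m X) i j.
have evX (T : comAlgType R) (g : 'M[T]_2) : map_mx (mpoly_ev (mxvec g 0)) X = g.
  apply: (can_inj mxvecK); apply/rowP => k.
  by rewrite -map_mxvec /X vec_mxK !mxE /mpoly_ev mmapX mmap1U.
have evK (T : comAlgType R) (g : 'M[T]_2) M :
    map_mx (mpoly_ev (mxvec g 0)) (K M) = map_mx (structure_map T) M.
  by apply/matrixP => i j; rewrite !mxE /mpoly_ev mmapC.
have evE (T : comAlgType R) (g : 'M[T]_2) :
    (forall p, E p -> mpoly_ev (mxvec g 0) p = 0) <->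
    g ^+ n = 1 /\ forall M, S M ->
      g *m map_mx (structure_map T) M = map_mx (structure_map T) M *m g.
  have evB p q : mpoly_ev (mxvec g 0) (p - q) =
      mpoly_ev (mxvec g 0) p - mpoly_ev (mxvec g 0) q by exact: rmorphB.
  pose ev : {rmorphism {mpoly R[2 * 2]} -> T} := mmap (in_alg T) (mxvec g 0).
  have ev_map (Y : 'M_2) i j : mpoly_ev (mxvec g 0) (Y i j) = map_mx ev Y i j.
    by rewrite mxE.
  have evX' : map_mx ev X = g := evX T g.
  have evK' M : map_mx ev (K M) = map_mx (structure_map T) M := evK T g M.
  have evn i j : mpoly_ev (mxvec g 0) ((X ^+ n - 1) i j) = (g ^+ n - 1) i j.
    by rewrite ev_map rmorphB rmorphXn rmorph1 /= evX'.
  have evc M i j : mpoly_ev (mxvec g 0) ((X *m K M - K M *m X) i j) =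
      (g *m map_mx (structure_map T) M - map_mx (structure_map T) M *m g) i j.
    by rewrite ev_map map_mxB !map_mxM evX' evK'.
  split=> [gE|[gn gS] p [i [j [->|[M SM ->]]]]]; last 2 first.
  - by rewrite evn gn subrr mxE.
  - by rewrite evc gS // subrr mxE.
  split=> [|M SM]; apply/subr0_eq/matrixP => i j.
    by rewrite -evn [RHS]mxE; apply: gE; exists i, j; left.
  by rewrite -evc [RHS]mxE; apply: gE; exists i, j; right; exists M.
exists E => T g; split=> [[det_g gP]|[det_g gE]].
  split=> // p Ep; apply: (cover_separated (U := U)) => T' f i u.
  rewrite mpoly_ev_map_mx; move: p Ep; apply/evE/(SP i T' u _); last exact: gP.
  by rewrite det_map_mx det_g rmorph1.
split=> // T' f i u; apply/(SP i T' u); first by rewrite det_map_mx det_g rmorph1.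
by apply/evE => p Ep; rewrite -mpoly_ev_map_mx gE // rmorph0.
Qed.

End FormOfFrame.

Lemma diag2_scalar (R : comNzRingType) (T : comAlgType R) (a : T) :
  diag2 a a = a%:M.
Proof.
have [e1 e2 e3 e4] := diag2E a a.
by apply: mx2P; rewrite ?e1 ?e2 ?e3 ?e4 mxE.
Qed.

Section FormOfCocycle.
Variables (R : comNzRingType) (n : nat).
Hypothesis n_gt1 : (1 < n)%N.
Variables (U : fppf_cover R) (c : cocycle U (normalizer_mu R n)).
Variable x : forall i, 'M[U i]_2.
Hypothesis cx : frame c x.

Let xGL i : GL_points (x i). Proof. by case: cx. Qed.

Lemma scalar_commutant (T : comAlgType R) (g : 'M[T]_2) :
  (forall M : 'M[R^o]_2, g *m map_mx (structure_map T) M =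
                         map_mx (structure_map T) M *m g) ->
  g = (g 0 0)%:M.
Proof.
move=> gc.
have D k l : map_mx (structure_map T) (delta_mx k l : 'M[R^o]_2) = delta_mx k l.
  by rewrite map_delta_mx.
have gD k l : g *m delta_mx k l = delta_mx k l *m g by rewrite -D gc.
have E01 i j := congr1 (fun M : 'M__ => M i j) (gD 0 1).
have E10 i j := congr1 (fun M : 'M__ => M i j) (gD 1 0).
have e1 := E01 1 1; have e2 := E01 0 1; have e3 := E10 0 0.
rewrite !mulmx2E !mxE /= !(mulr0, mul0r, addr0, add0r, mulr1, mul1r) in e1 e2 e3.
by apply: mx2P; rewrite mxE //= ?mulr1n ?mulr0n.
Qed.

(** For n > 2 the matrices M are the products of an entry of split_coord with
    split_coord itself: by split_coord_twist_mul they do not depend on the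
    member of the covering, hence they descend to R. *)
Lemma frame_equations : exists S : 'M[R^o]_2 -> Prop,
  forall i (T : comAlgType R) (u : {lrmorphism U i -> T}) (g : 'M[T]_2),
     \det g = 1 ->
     (exists2 h, mu R n T h & g *m map_mx u (x i) = map_mx u (x i) *m h) <->
     g ^+ n = 1 /\ forall M, S M ->
       g *m map_mx (structure_map T) M = map_mx (structure_map T) M *m g.
Proof.
have [n_gt2|n_le2] := ltnP 2 n; last first.
  (* mu_2 consists of scalars, and is fixed by conjugation *)
  have n2 : n = 2 by apply/eqP; rewrite eqn_leq n_le2.
  exists (fun=> True) => i T u g det_g; have uGL := GL_map u (xGL i).
  split=> [[h [a [b [an ab hE]]] gh]|[gn gc]].
    have ba : b = a by rewrite -[b]mul1r -an n2 expr2 -mulrA ab mulr1.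
    have hS : h = a%:M by rewrite hE ba diag2_scalar.
    have -> : g = a%:M.
      by rewrite -[g](mulmxIK uGL) gh hS scalar_mxC mulmxIK.
    split=> [|M _]; last by rewrite scalar_mxC.
    by rewrite -diag2_scalar diag2X an diag2_1.
  have gS := scalar_commutant (fun M => gc M I).
  exists g; last by rewrite gS scalar_mxC.
  have gg : g 0 0 * g 0 0 = 1.
    have := congr1 (fun M : 'M__ => M 0 0) gn.
    by rewrite n2 gS -diag2_scalar diag2X expr2 !mxE.
  exists (g 0 0), (g 0 0); split=> //; first by rewrite n2 expr2.
  by rewrite diag2_scalar.
pose z k l (T : comAlgType R) (a : {lrmorphism R^o -> T}) j
  (w : {lrmorphism U j -> T}) : 'M[T]_2 :=
  split_coord (map_mx w (x j)) k l *: split_coord (map_mx w (x j)).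
have H k l : exists M : 'M[R^o]_2, forall (T : comAlgType R)
    (a : {lrmorphism R^o -> T}) j (w : {lrmorphism U j -> T}),
    z k l T a j w = map_mx a M.
  apply: (@cover_descent_mx R U R^o 2 2 (z k l)) => [T T' f a j w|T a j w j' w'].
    have wGL := GL_map w (xGL j); have fE := map_split_coord f wGL.
    rewrite /z (_ : split_coord _ = map_mx f (split_coord (map_mx w (x j)))).
      move: (split_coord _) => S.
      by apply/matrixP => p q; rewrite !mxE rmorphM.
    by rewrite fE -map_mx_comp.
  have [_ xc] := cx; rewrite /z -(xc _ _ _ w w').
  rewrite (split_coord_twist_mul n_gt2) //; first exact: GL_map.
  exact: coc_in.
exists (fun M => exists k l, M = sval (cid (H k l))) => i T u g det_g.
have uGL := GL_map u (xGL i).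
have HE k l : map_mx (structure_map T) (sval (cid (H k l))) =
    split_coord (map_mx u (x i)) k l *: split_coord (map_mx u (x i)).
  by case: cid => M /= /(_ T (structure_map T) i u) <-.
rewrite (mu_conjP _ _ uGL).
split=> [[_ gn /(comm_split_coord _ uGL) gc]|[gn gc]].
  by split=> // _ [k [l ->]]; rewrite HE gc.
split=> //; apply/(comm_split_coord _ uGL) => k l.
by rewrite -HE; apply: gc; exists k, l.
Qed.

(** Membership over one member of the covering implies membership over the
    others since c normalizes mu_n. *)
Lemma frame_functor_conj_by i : conj_by (mu R n) (frame_functor n x) (x i).
Proof.
move=> T u g; have uGL := GL_map u (xGL i).
split=> [[_ gP]|[h hmu gh]].
  by have [h hmu] := gP T idfun i u; rewrite (map_mx_id (frefl _)) => ?; exists h.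
have gE : g = map_mx u (x i) *m h *m mxinv (map_mx u (x i)).
  by rewrite -gh mulmxIK.
split=> [|T' f j v].
  have [a [b [_ ab hE]]] := hmu.
  rewrite gE !det_mulmx mulrAC -det_mulmx mulmxI // det1 mul1r hE det_mx2.
  by have [-> -> _ ->] := diag2E a b; rewrite mul0r subr0.
have [_ xc] := cx; have cN := coc_in c v (f \o u).
have xE : map_mx v (x j) *m c j i T' v (f \o u) = map_mx f (map_mx u (x i)).
  by rewrite xc map_mx_comp.
have [_ cP] := cN.
have [k kmu kE] := cP T' idfun (map_mx f h) (points_map f hmu).
exists k => //; rewrite !(map_mx_id (frefl _)) in kE.
have cGL := points_GL cN; have vGL := GL_map v (xGL j).
have E : map_mx f g *m (map_mx v (x j) *m c j i T' v (f \o u)) =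
    map_mx v (x j) *m c j i T' v (f \o u) *m map_mx f h.
  by rewrite xE -!map_mxM gh.
rewrite -[LHS](mulmxIK cGL) -(mulmxA (map_mx f g)) E -(mulmxA (map_mx v _)) -kE.
by rewrite !mulmxA mulmxIK.
Qed.

Lemma frame_twisted_form :
  exists F : twisted_form R n, forall i, conj_by (mu R n) (sval F) (x i).
Proof.
have [S SP] := frame_equations.
have closed := frame_functor_closed SP.
have locally_mu : exists V : fppf_cover R, forall j,
    conjugate_over (V j) (mu R n) (frame_functor n x).
  by exists U => j; exists (x j) => //; apply: frame_functor_conj_by.
exists (exist _ (frame_functor n x) (conj closed locally_mu)) => i.
exact: frame_functor_conj_by.
Qed.

End FormOfCocycle.

(** * Forms and classes of cocycles *)
Section Presentation.
Variables (R : comNzRingType) (n : nat).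
Local Notation mu := (mu R n).
Local Notation N := (normalizer_mu R n).
Implicit Types (F : subgroup_functor R 2) (c d : coc_on_cover N).

(** The relation between forms and cocycles which yields the bijection. *)
Definition presents F c : Prop :=
  exists2 x, frame (tagged c) x & forall i, conj_by mu F (x i).

Lemma cocycle_of_frame F (U : fppf_cover R) (x : forall i, 'M[U i]_2) :
  (forall i, GL_points (x i)) -> (forall i, conj_by mu F (x i)) ->
  exists c : cocycle U N, frame c x.
Proof.
move=> xGL xF.
pose coc i j (T : comAlgType R) (u : {lrmorphism U i -> T})
  (v : {lrmorphism U j -> T}) := mxinv (map_mx u (x i)) *m map_mx v (x j).
have coc_in i j (T : comAlgType R) (u : {lrmorphism U i -> T})
    (v : {lrmorphism U j -> T}) : N T (coc i j T u v).
  have uGL := GL_map u (xGL i); have vGL := GL_map v (xGL j).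
  apply: normalizes_conj_by.
    by apply: GLM => //; apply: mxinv_GL.
  apply: (conj_byM (G := F)); first exact: mxinv_GL.
    by apply: conj_byV => //; apply: conj_by_map.
  exact: conj_by_map.
have coc_nat i j (T T' : comAlgType R) (f : {lrmorphism T -> T'})
    (u : {lrmorphism U i -> T}) (v : {lrmorphism U j -> T}) :
    coc i j T' (f \o u) (f \o v) = map_mx f (coc i j T u v).
  rewrite /coc map_mxM mxinv_map; last exact: GL_map.
  by rewrite -!map_mx_comp.
have coc_mul i j k (T : comAlgType R) (u : {lrmorphism U i -> T})
    (v : {lrmorphism U j -> T}) (w : {lrmorphism U k -> T}) :
    coc i j T u v *m coc j k T v w = coc i k T u w.
  by rewrite /coc mulmxA mulmxIK //; apply: GL_map.
exists (Cocycle coc_in coc_nat coc_mul); split=> // i j T u v.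
by rewrite /= /coc mulIVKmx //; apply: GL_map.
Qed.

Lemma twisted_form_presented (F : twisted_form R n) :
  exists c, presents (sval F) c.
Proof.
have [_ [U UF]] := svalP F.
have /choice_dep[x xP] : forall j, exists y : 'M[U j]_2,
    GL_points y /\ conj_by mu (sval F) y.
  by move=> j; have [y ? ?] := UF j; exists y.
have [c cx] := @cocycle_of_frame (sval F) U x
  (fun i => (xP i).1) (fun i => (xP i).2).
by exists (Tagged (fun V => cocycle V N) c), x => // i; case: (xP i).
Qed.

Section UnionCover.
Variables U V : fppf_cover R.

(** Both U and V refine their disjoint union, which replaces a common
    refinement when cocycles on U and V are compared. *)
Definition union_alg (s : cover_idx U + cover_idx V) : comAlgType R :=
  match s with inl i => U i | inr j => V j end.

Fact union_flat s : flat (union_alg s).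
Proof. by case: s => ? /=; apply: cover_flat. Qed.
Fact union_fp s : finitely_presented (union_alg s).
Proof. by case: s => ? /=; apply: cover_fp. Qed.
Fact union_surj (P : prime_idealr R) :
  exists s (Q : prime_idealr (union_alg s)),
    forall a : R, (a%:A \in Q) = (a \in P).
Proof. by have [j [Q QP]] := cover_surj U P; exists (inl j), Q. Qed.

Definition union_cover : fppf_cover R :=
  @FppfCover R (cover_idx U + cover_idx V)%type union_alg
    union_flat union_fp union_surj.

Definition union_refl : refinement union_cover U :=
  @Refinement R union_cover U inl (fun j => idfun : {lrmorphism U j -> U j}).
Definition union_refr : refinement union_cover V :=
  @Refinement R union_cover V inr (fun j => idfun : {lrmorphism V j -> V j}).

End UnionCover.

Lemma frame_restr_step (U V : fppf_cover R) (r : refinement U V)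
    (w : cocycle U N) (c : cocycle V N) (z : forall i, 'M[U i]_2)
    (x : forall j, 'M[V j]_2) :
  frame w z -> frame c x ->
  (forall j, map_mx (ref_map r j) (z (ref_idx r j)) = x j) ->
  coc_step (Tagged (fun W => cocycle W N) w) (Tagged (fun W => cocycle W N) c).
Proof.
move=> [zGL wz] [xGL cx] zx; exists r; exists (fun=> 1%:M) => [i|i j T u v].
  exact: normalizer1.
rewrite !map_mx1 mul1mx mulmx1 /=; have uGL := GL_map u (xGL i).
rewrite -[LHS](mulIKmx uGL) cx -[RHS](mulIKmx uGL); congr (_ *m _).
rewrite -!zx -!map_mx_comp; apply/esym.
exact: (wz _ _ _ (u \o ref_map r i) (v \o ref_map r j)).
Qed.

(** The frames on U and V of one form together are a frame on the disjoint
    union, and its cocycle restricts to both cocycles. *)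
Lemma presents_class F c d :
  presents F c -> presents F d ->
  quot_pi (@coc_step R 2 N) c = quot_pi (@coc_step R 2 N) d.
Proof.
case: c d => [U c] [V d] [x cx xF] [y dy yF].
pose z (s : cover_idx (union_cover U V)) : 'M[union_cover U V s]_2 :=
  match s with inl i => x i | inr j => y j end.
have zGL s : GL_points (z s) by case: s => j /=; [case: cx | case: dy].
have zF s : conj_by mu F (z s) by case: s => j /=; [apply: xF | apply: yF].
have [w wz] := cocycle_of_frame zGL zF.
apply/quot_piP; apply: (rst_trans _ _ _ (Tagged (fun W => cocycle W N) w)).
  apply/rst_sym/rst_step; apply: (frame_restr_step (r := union_refl U V) wz cx) => j.
  exact: (map_mx_id (frefl _)).
apply/rst_step; apply: (frame_restr_step (r := union_refr U V) wz dy) => j.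
exact: (map_mx_id (frefl _)).
Qed.

Lemma presents_conj F F' c :
  conjugate_over R^o F F' -> presents F c -> presents F' c.
Proof.
case: c => U c [y yGL yP] [x [xGL cx] xF].
exists (fun i => map_mx (@structure_map R (U i)) y *m x i).
  split=> [i|i j T u v]; first by apply: GLM => //; apply: GL_map.
  rewrite !map_mxM -mulmxA cx; congr (_ *m _); apply/matrixP => k l.
  by rewrite !mxE /= !linearZ /= !rmorph1.
move=> i; apply: (conj_byM (G := F)) => //; first exact: GL_map.
exact: (conj_by_map _ yP).
Qed.

Lemma conjugate_over_sym F F' : conjugate_over R^o F F' -> conjugate_over R^o F' F.
Proof.
move=> [y yGL yP]; exists (mxinv y); first exact: mxinv_GL.
exact: conj_byV.
Qed.

(** The matrices y_j x_j^-1 agree on overlaps, both frames having the same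
    cocycle. *)
Lemma presents_unique F F' c : closed_in_SL F -> closed_in_SL F' ->
  presents F c -> presents F' c -> conjugate_over R^o F F'.
Proof.
case: c => U c Fc Fc' [x [xGL cx] xF] [y [yGL cy] yF'].
have [X XGL XP] : exists2 X : 'M[R^o]_2, GL_points X & forall (T : comAlgType R)
    (a : {lrmorphism R^o -> T}) j (w : {lrmorphism U j -> T}),
    map_mx w (y j) *m mxinv (map_mx w (x j)) = map_mx a X.
  apply: (cover_descent_GL (z := fun T (a : {lrmorphism R^o -> T}) j w =>
    map_mx w (y j) *m mxinv (map_mx w (x j))))
    => [T T' f a j w|T a j w k w'|T a j w].
  - rewrite map_mxM mxinv_map; last exact: GL_map.
    by rewrite -!map_mx_comp.
  - have wGL := GL_map w (xGL j); have wGL' := GL_map w' (xGL k).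
    rewrite -[LHS](mulmxIK wGL') -(cx _ _ _ w w') -(cy _ _ _ w w') /=.
    by congr (_ *m _); rewrite mulmxA mulmxIVK.
  - by apply: GLM; [|apply: mxinv_GL]; apply: GL_map.
exists X => //; apply: (conj_by_local (U := U)) => // T u j w.
rewrite -(XP T u j w); apply: (conj_byM (G := mu)).
- exact: GL_map.
- exact: conj_by_map.
- by apply: conj_byV; [apply: GL_map | apply: conj_by_map].
Qed.

Lemma presents_step F c d : coc_step c d -> presents F c -> presents F d.
Proof.
move=> [r [h hN cd]] [x cx xF].
exists (fun j => map_mx (ref_map r j) (x (ref_idx r j)) *m h j).
  exact: frame_push cd.
move=> j; apply: (conj_byM (G := mu)); first by apply: GL_map; case: cx.
  exact: conj_by_map.
exact: normalizer_conj_by.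
Qed.

Section Classes.
Hypothesis n_gt1 : (1 < n)%N.
Local Notation conj_rel :=
  (fun F F' : twisted_form R n => conjugate_over R^o (sval F) (sval F')).

Lemma framed_presented c : framed c ->
  exists F : twisted_form R n, presents (sval F) c.
Proof.
case: c => U c [x cx]; have [F FP] := frame_twisted_form n_gt1 cx.
by exists F, x.
Qed.

Lemma presents_unique_class (F F' : twisted_form R n) c :
  presents (sval F) c -> presents (sval F') c ->
  quot_pi conj_rel F = quot_pi conj_rel F'.
Proof.
move=> Fc Fc'; apply/quot_piP/rst_step; apply: presents_unique Fc Fc'.
- by case: (svalP F).
- by case: (svalP F').
Qed.

(** By induction on a chain of refinements.  In the middle of a chain, the
    existence of a frame provides a form that can be compared to both ends. *)
Lemma presents_eqv c d : eqv_class (@coc_step R 2 N) c d ->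
  (framed c <-> framed d) /\
  forall F F' : twisted_form R n, presents (sval F) c -> presents (sval F') d ->
    quot_pi conj_rel F = quot_pi conj_rel F'.
Proof.
elim=> {c d} [c d cd|c|c d _ [fcd cd]|c d e _ [fcd cd] _ [fde de]].
- split=> [|F F' Fc]; first exact: framed_step.
  by apply: presents_unique_class; apply: presents_step Fc.
- by split=> // F F'; apply: presents_unique_class.
- by split=> [|F F' Fd Fc]; [split=> /fcd | apply/esym/cd].
split=> [|F F' Fc Fe]; first by rewrite fcd.
have [G Gd] : exists G : twisted_form R n, presents (sval G) d.
  by apply: framed_presented; apply/fcd; have [x cx _] := Fc; exists x.
by rewrite (cd F G) // (de G F').
Qed.

Lemma presents_form_eqv (F F' : twisted_form R n) c : eqv_class conj_rel F F' ->
  presents (sval F) c <-> presents (sval F') c.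
Proof.
elim=> {F F'} [F F' FF'|F|F F' _ E|F G H _ FG _ GH].
- by split; apply: presents_conj => //; apply: conjugate_over_sym.
- by [].
- by split=> /E.
- by rewrite FG.
Qed.

(** A frame of an N-valued cocycle is one of its image in GL_2. *)
Lemma framed_ker c : framed c <->
  H1_map (@normalizer_GL R n) (quot_pi (@coc_step R 2 N) c) = H1_base (GL R 2).
Proof.
pose c' : coc_on_cover (GL R 2) :=
  Tagged (fun U => cocycle U (GL R 2)) (coc_incl (@normalizer_GL R n) (tagged c)).
have -> : H1_map (@normalizer_GL R n) (quot_pi (@coc_step R 2 N) c) =
    quot_pi (@coc_step R 2 (GL R 2)) c'.
  apply: eq_exist; apply/funext => d; apply/propext; split=> [[e ce ed]|c'd].
    apply: rst_trans ed; rewrite /c'.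
    elim: ce => {d e}
      [e e' /(coc_step_incl (@normalizer_GL R n))|e|e e' _|e e1 e2 _ E _].
    - exact: rst_step.
    - exact: rst_refl.
    - exact: rst_sym.
    - exact: rst_trans E.
  by exists c => //; apply: rst_refl.
by rewrite framed_GL_base.
Qed.

End Classes.
End Presentation.

Lemma bijective_of_rel (X Y : Type) (r : X -> Y -> Prop) :
  (forall x, exists y, r x y) -> (forall y, exists x, r x y) ->
  (forall x y y', r x y -> r x y' -> y = y') ->
  (forall x x' y, r x y -> r x' y -> x = x') ->
  exists f : X -> Y, bijective f.
Proof.
move=> /choice[f fP] /choice[g gP] r_fun r_inj; exists f, g => [x|y].
- exact: r_inj (gP _) (fP _).
- exact: r_fun (fP _) (gP _).
Qed.

Lemma forms_kernel_bijection (R : comNzRingType) (n : nat) : (1 < n)%N ->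
  exists f : forms_up_to_conj R n -> H1_ker (@normalizer_GL R n), bijective f.
Proof.
move=> hn.
pose conj_rel (F F' : twisted_form R n) := conjugate_over R^o (sval F) (sval F').
pose r (C : forms_up_to_conj R n) (D : H1_ker (@normalizer_GL R n)) :=
  exists (F : twisted_form R n) (c : coc_on_cover (normalizer_mu R n)),
    [/\ C = quot_pi conj_rel F, sval D = quot_pi (@coc_step R 2 _) c
      & presents (sval F) c].
have framed_of (F : twisted_form R n) (c : coc_on_cover (normalizer_mu R n)) :
    presents (sval F) c -> framed c.
  by case=> x cx _; exists x.
have quot_ind (T : Type) (s : T -> T -> Prop) (C : quot s) :
    exists x, C = quot_pi s x.
  by case: C => C [x Cx]; exists x; apply: eq_exist.
apply: (bijective_of_rel (r := r)).
- move=> C; have [F ->] := quot_ind _ _ C.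
  have [c Fc] := twisted_form_presented F.
  have /framed_ker cker := framed_of _ _ Fc.
  by exists (exist (fun D => H1_map (@normalizer_GL R n) D = _) _ cker), F, c.
- move=> [D Dker]; have [c DE] := quot_ind _ _ D.
  have [|F Fc] := @framed_presented R n hn c.
    by apply/framed_ker; rewrite -DE.
  by exists (quot_pi conj_rel F), F, c.
- move=> C [D Dker] [D' Dker'] [F [c [-> /= DE Fc]]] [F' [c' [CE /= DE' Fc']]].
  apply: eq_exist; rewrite DE DE'; apply: presents_class Fc _.
  by apply/(presents_form_eqv _ (proj1 (quot_piP _ _ _) CE)).
- move=> C C' [D Dker] [F [c [-> /= DE Fc]]] [F' [c' [-> /= DE' Fc']]].
  have cc' : eqv_class (@coc_step R 2 _) c c' by apply/quot_piP; rewrite -DE.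
  by have [_] := presents_eqv hn cc'; apply.
Qed.

Theorem theorem1p2 (K : fieldExtType rat) (n : nat) (hn : (1 < n)%N) :
  exists f : forms_up_to_conj (ringOfIntegers K) n ->
             H1_ker (@normalizer_GL (ringOfIntegers K) n),
    bijective f.
Proof. exact: forms_kernel_bijection. Qed.
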